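(* Let $(E,\pi)$ be a standard Borel space endowed with a probability measure $\pi$, let $T:E\to F$ be a measurable map into a standard Borel space $F$, let $\mathcal{C}_T\subset\mathcal{P}(F)$ be a convex set, and let $$\mathcal{C}=\{\eta\in\mathcal{P}(E):\ T\sharp\eta\in\mathcal{C}_T\}.$$ Assume that $\mathcal{C}$ contains the unique associated entropy minimizing distribution $\mu_\ast=\operatorname{arg\,min}_{\mu\in\mathcal{C}}\mathrm{Ent}(\mu\mid\pi)$, and let $\mathcal{A}\subset\mathcal{C}$ be a set of admissible target distributions. Assume that: 1. the conditional distributions $\pi(\,\cdot\mid T=t)$ are atomless for $T\sharp\pi$-almost every $t$; 2. $\mathcal{A}$ contains at least all distributions having an indicator density with respect to $\mu_\ast$. Then for any real $h\ge h_\ast:=\mathrm{Ent}(\mu_\ast\mid\pi)$, any bounded measurable $f:E\to\mathbb{R}$, and any $\varepsilon>0$, the set $\mathcal{A}$ contains a distribution $\eta_{f,h,\varepsilon}$ such that $$\left|\mathrm{Ent}(\eta_{f,h,\varepsilon}\mid\pi)-h\right|\le\varepsilon\quad\text{and}\quad\eta_{f,h,\varepsilon}(f)\ge\mu_\ast(f)-\varepsilon .$$ In particular, for any real $h\ge h_\ast$, $$\mathrm{WLC}_h(\mu_\ast\mid\pi)=-\mathrm{Ent}(\mu_\ast\mid\pi)$$ and $$\forall\mu\in\mathcal{P}(E),\qquad\mathrm{WLC}_h(\mu\mid\pi)\ \ge\ \mathrm{WLC}_h(\mu_\ast\mid\pi)+\mathrm{Ent}(\mu\mid\mu_\ast).$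$
   Context: $\mathcal{P}(E)$ is the set of probability measures on $E$; $T\sharp\eta$ is the push-forward of $\eta$ by $T$; $\eta(f)=\int f\,d\eta$. For $\eta,\mu\in\mathcal{P}(E)$, $\mathrm{Ent}(\eta\mid\mu)=\int\ln\frac{d\eta}{d\mu}\,d\eta\in[0,+\infty]$ if $\eta\ll\mu$, and $+\infty$ otherwise. The entropy minimizing distribution $\mu_\ast$ is assumed to have finite entropy $\mathrm{Ent}(\mu_\ast\mid\pi)<+\infty$. $\pi(\,\cdot\mid T=t)$ denotes the regular conditional distribution (disintegration) of $\pi$ given $T=t$. A distribution has an indicator density with respect to $\mu_\ast$ if it is of the form $\mu_\ast(\,\cdot\mid A)=\frac{1}{\mu_\ast(A)}\mathbf{1}_A\,\mu_\ast$ for some measurable $A\subset E$ with $\mu_\ast(A)>0$. The worst-case log-cost of a proposal $\mu\in\mathcal{P}(E)$ is $$\mathrm{WLC}_h(\mu\mid\pi)=\sup_{\eta\in\mathcal{A},\ \mathrm{Ent}(\eta\mid\pi)\le h}\mathrm{Ent}(\eta\mid\mu)-h .$$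
   Formalization: The last inequality is proved with Ent(μ_*|μ) in place of Ent(μ|μ_* ), since the printed order fails (π Lebesgue on [0,1], C=A=P(E), h=0, μ=(π+δ_0)/2); assumption 2 is required only for indicator-density distributions that lie in C. *)

(* Defs.v *)
From HB Require Import structures.
From mathcomp Require Import all_boot all_order all_algebra.
From mathcomp Require Import all_classical all_reals all_analysis.
Import Order.TTheory GRing.Theory Num.Theory.
Import numFieldNormedType.Exports.

Set Implicit Arguments.
Unset Strict Implicit.
Unset Printing Implicit Defensive.

Local Open Scope classical_set_scope.
Local Open Scope ring_scope.
Local Open Scope ereal_scope.
Local Open Scope charge_scope.

(* A Polish space is presented as a complete, Hausdorff, second countable
   pseudometric space (over R); E is standard Borel when its sigma-algebra is,
   up to a bijection, the Borel sigma-algebra of such a space. *)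
Definition standard_borel (R : realType) (d : measure_display)
    (E : measurableType d) : Prop :=
  exists (X : completePseudoMetricType R) (j : E -> X),
    [/\ hausdorff_space X, @second_countable X, bijective j &
        forall A : set E, measurable A <->
          exists2 B : set X, <<s [set U : set X | open U] >> B & A = j @^-1` B].

Section distributions.
Context {R : realType} {d : measure_display} {E : measurableType d}.
Implicit Types (eta mu nu : probability E R) (S : set (probability E R)).

(* A [probability E R] also carries (irrelevant) values on the non-measurable
   subsets of E, so two of its terms denote the same element of P(E) when they
   agree on the measurable sets, and a subset of P(E) is a [set] that does not
   distinguish such terms. *)
Definition same_distribution mu nu : Prop :=
  forall A : set E, measurable A -> mu A = nu A.

Definition distribution_set S : Prop :=
  forall mu nu, same_distribution mu nu -> S mu -> S nu.

Definition convex_distribution_set S : Prop :=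
  forall (p : R) mu0 mu1 nu, (0 <= p <= 1)%R -> S mu0 -> S mu1 ->
    (forall A : set E, measurable A ->
       nu A = p%:E * mu0 A + (1 - p)%:E * mu1 A) ->
    S nu.

Definition Ent eta mu : \bar R :=
  if `[< eta `<< mu >] then
    \int[eta]_x lne (('d (charge_of_finite_measure eta) '/d mu) x)
  else +oo.

Definition is_unique_entropy_minimizer S (pi mu : probability E R) : Prop :=
  S mu /\
  forall eta, S eta ->
    Ent mu pi <= Ent eta pi /\
    (Ent eta pi = Ent mu pi -> same_distribution eta mu).

Definition atomless (mu : {measure set E -> \bar R}) : Prop :=
  forall A : set E, measurable A -> 0 < mu A ->
    exists B : set E, [/\ measurable B, B `<=` A, 0 < mu B & mu B < mu A].

(* eta = mu( . | A) for some A of positive mu-measure.  When distributions are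
   constrained to a set C, only the eta of this form that lie in C are
   candidates: for a general A, mu( . | A) violates the constraint. *)
Definition has_indicator_density mu eta : Prop :=
  exists A : set E, [/\ measurable A, 0 < mu A &
    forall B : set E, measurable B ->
      eta B = ((fine (mu A))^-1)%:E * mu (A `&` B)].

(* With mustar the entropy minimizer, the excess WLC mu - WLC mustar is bounded
   below by Ent mustar mu.  The argument order matters: Ent mu mustar would not
   be a lower bound, since for mu = (pi + dirac)/2, mustar = pi atomless and
   h = 0 the excess is Ent pi mu = ln 2 whereas Ent mu pi = +oo. *)
Definition WLC S (pi : probability E R) (h : R) mu : \bar R :=
  ereal_sup [set Ent eta mu | eta in [set eta | S eta /\ Ent eta pi <= h%:E]]
  - h%:E.

End distributions.

Definition constraint_set (R : realType) (dE dF : measure_display)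
    (E : measurableType dE) (F : measurableType dF) (T : {mfun E >-> F})
    (CT : set (probability F R)) : set (probability E R) :=
  [set eta | CT (distribution eta T)].

(* kappa t is (a version of) pi( . | T = t).  On standard Borel spaces such a
   kernel exists and is unique up to a null set of t. *)
Definition is_conditional_distribution (R : realType)
    (dE dF : measure_display) (E : measurableType dE) (F : measurableType dF)
    (pi : probability E R) (T : {mfun E >-> F}) (kappa : R.-pker F ~> E) :
    Prop :=
  forall (A : set E) (B : set F), measurable A -> measurable B ->
    pi (A `&` T @^-1` B) = \int[distribution pi T]_(t in B) kappa t A.

(* Main.v *)
Require Import Defs.
From HB Require Import structures.
From mathcomp Require Import all_boot all_order all_algebra.
From mathcomp Require Import all_classical all_reals all_analysis.
From mathcomp Require Import measurable_realfun ring lra.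
Import Order.TTheory GRing.Theory Num.Theory.
Import numFieldNormedType.Exports.

Set Implicit Arguments.
Unset Strict Implicit.
Unset Printing Implicit Defensive.

Local Open Scope classical_set_scope.
Local Open Scope ring_scope.
Local Open Scope ereal_scope.

(** Two facts carry the theorem.

    The minimizer is a reweighting of [pi] by a function of [T]. The constraint
    only sees the image law under [T]; by Gibbs' inequality, among all laws with
    the image law of [mustar], the one whose density is a function of [T] has
    the least entropy, so that uniqueness forces [mustar = (g o T) pi]
    ([minimizer_density]). Along the fibres of [T], [mustar] is therefore
    as atomless as [pi].

    Fibrewise atomless laws can be thinned. Cut every fibre of [T], and in it
    every level of a countable label [s], at its conditional quantile of order
    [alpha] for some injection of [E] into the reals: this gives a set [B] that
    meets each fibre and each label in the proportion [alpha]
    ([conditional_thinning], [thinned_target]). The conditioned law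
    [eta = mustar( . | B)] then has the same image law as [mustar], so it meets
    the constraint, and the same law of labels. As [g o T] has the same law under
    [eta] and [mustar], the entropy of [eta] is [Ent mustar pi - ln alpha]
    ([indicator_Ent]), which equals [h] exactly when
    [alpha = exp (Ent mustar pi - h)]. Taking for [s] the integer part of
    [f / eps], the integral of [f] under [eta] is at least its integral under
    [mustar] up to [eps] ([floor_label_integral]), even if [f] is unbounded.

    The worst-case costs follow. With respect to [mustar] these targets have
    entropy [h - Ent mustar pi], and no admissible law has more: a law [eta] in
    the convex set of constraints satisfies Csiszar's Pythagorean inequality
    [Ent eta mustar + Ent mustar pi <= Ent eta pi] ([pythagoras]), the first-order
    condition of minimality along the segment from [mustar] to [eta]. For a
    proposal [mu] that dominates [mustar], apply the construction to
    [f = ln (d mustar / d mu)]: the entropy of [eta] with respect to [mu] is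
    [- ln alpha] plus the integral of [f] under [eta], hence at least
    [h - Ent mustar pi + Ent mustar mu] up to [eps]. If [mu] does not dominate
    [mustar], the target [mustar] itself has infinite cost. *)

(** * Integrals with an integrable negative part *)

Section semi_integrable.
Context {R : realType} {d : measure_display} {T : measurableType d}.
Variable mu : {measure set T -> \bar R}.
Implicit Types f g : T -> R.

Definition neg_integrable f := \int[mu]_x ((EFin \o f)^\- x) < +oo.

Lemma ae_le_integral f g : measurable_fun [set: T] f ->
  measurable_fun [set: T] g -> {ae mu, forall x, (f x <= g x)%R} ->
  \int[mu]_x (f x)%:E <= \int[mu]_x (g x)%:E.
Proof.
move=> /measurable_EFinP mf /measurable_EFinP mg fg.
rewrite integralE [leRHS]integralE; apply: leeB.
- apply: ae_ge0_le_integral => //; [exact: measurable_funepos..|].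
  apply: filterS fg => x fg _; rewrite !funeposE.
  by rewrite /maxe !lte_fin; case: ifPn; case: ifPn; rewrite ?lee_fin//=; lra.
- apply: ae_ge0_le_integral => //; [exact: measurable_funeneg..|].
  apply: filterS fg => x fg _; rewrite !funenegE.
  by rewrite /maxe !lte_fin; case: ifPn; case: ifPn; rewrite ?lee_fin//=; lra.
Qed.

Lemma ae_eq_integral_real f g : measurable_fun [set: T] f ->
  measurable_fun [set: T] g -> {ae mu, forall x, f x = g x} ->
  \int[mu]_x (f x)%:E = \int[mu]_x (g x)%:E.
Proof.
move=> mf mg fg; apply/eqP; rewrite eq_le; apply/andP; split;
  by apply: ae_le_integral => //; apply: filterS fg => x ->.
Qed.

Lemma ae_eq_integrable_real f g : measurable_fun [set: T] f ->
  measurable_fun [set: T] g -> {ae mu, forall x, f x = g x} ->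
  mu.-integrable [set: T] (EFin \o f) -> mu.-integrable [set: T] (EFin \o g).
Proof.
move=> /measurable_EFinP mf /measurable_EFinP mg fg /integrableP[_ fy].
apply/integrableP; split => //; apply: le_lt_trans fy.
apply: ae_ge0_le_integral => //; [exact: measurableT_comp..|].
by apply: filterS fg => x /= ->.
Qed.

Lemma neg_integrableP f : measurable_fun [set: T] f -> neg_integrable f ->
  mu.-integrable [set: T] (EFin \o f) \/ \int[mu]_x (f x)%:E = +oo.
Proof.
move=> /measurable_EFinP mf nf.
have [pf|] := ltP (\int[mu]_x ((EFin \o f)^\+ x)) +oo.
  left; apply/integrableP; split => //.
  rewrite -[fun x => _]/(abse \o (EFin \o f)) fune_abse.
  rewrite ge0_integralD//; last 2 first.
  - exact: measurable_funepos.
  - exact: measurable_funeneg.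
  exact: lte_add_pinfty.
rewrite leye_eq => /eqP pf; right; rewrite integralE pf.
by move: nf; rewrite /neg_integrable; case: (\int[mu]_x _).
Qed.

Lemma integrable_neg_integrable f :
  mu.-integrable [set: T] (EFin \o f) -> neg_integrable f.
Proof. exact: integral_funeneg_lt_pinfty. Qed.

Lemma neg_integrable_fin f : measurable_fun [set: T] f -> neg_integrable f ->
  \int[mu]_x (f x)%:E < +oo -> mu.-integrable [set: T] (EFin \o f).
Proof. by move=> mf nf; have [//|->] := neg_integrableP mf nf. Qed.

Lemma neg_integral_gtNy f : measurable_fun [set: T] f -> neg_integrable f ->
  -oo < \int[mu]_x (f x)%:E.
Proof.
move=> mf nf; have [fi|->] := neg_integrableP mf nf; last by [].
by rewrite ltNye_eq integrable_fin_num.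
Qed.

(** Here [f] may have integral [+oo]; were [f + g] integrable, [f] would be too. *)
Lemma neg_integralD f g : measurable_fun [set: T] f -> neg_integrable f ->
  mu.-integrable [set: T] (EFin \o g) ->
  \int[mu]_x (f x + g x)%:E = \int[mu]_x (f x)%:E + \int[mu]_x (g x)%:E.
Proof.
move=> mf nf gi; have mg : measurable_fun [set: T] g.
  by apply/measurable_EFinP; exact: measurable_int gi.
have [fi|fy] := neg_integrableP mf nf.
  by under eq_integral do rewrite EFinD; rewrite integralD.
rewrite fy addye; last first.
  by have := integrable_fin_num measurableT gi; case: (\int[mu]_x _).
have mfg : measurable_fun [set: T] (f \+ g)%R by exact: measurable_funD.
have [//|] : mu.-integrable [set: T] (EFin \o (f \+ g)%R) \/
    \int[mu]_x (f x + g x)%:E = +oo; last by [].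
  apply: neg_integrableP => //.
  apply: (@le_lt_trans _ _ (\int[mu]_x ((EFin \o f)^\- x + (EFin \o g)^\- x))).
    apply: ge0_le_integral => //.
    - apply: measurable_funeneg; exact/measurable_EFinP.
    - by apply: emeasurable_funD; apply: measurable_funeneg; exact/measurable_EFinP.
    - move=> x _; rewrite !funenegE /=.
      rewrite /maxe !lte_fin; case: ifPn; case: ifPn; case: ifPn;
       rewrite -?EFinD ?lee_fin//=; lra.
  rewrite ge0_integralD//; [|exact/measurable_funeneg/measurable_EFinP..].
  by apply: lte_add_pinfty => //; exact: integral_funeneg_lt_pinfty.
move=> fgi; have : mu.-integrable [set: T] (EFin \o f).
  rewrite (_ : EFin \o f = (EFin \o (f \+ g)%R) \- (EFin \o g)); last first.
    by apply/funext => x /=; rewrite -EFinB addrK.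
  exact: integrableB.
by move=> /(integrable_fin_num measurableT); rewrite /comp fy.
Qed.

End semi_integrable.

(** * Densities and relative entropy *)

Section density.
Context {R : realType} {d : measure_display} {T : measurableType d}.
Implicit Types (eta mu : probability T R) (r s u : T -> R).

Definition density_of eta mu r := [/\ measurable_fun [set: T] r,
  forall x, (0 <= r x)%R &
  forall A, measurable A -> eta A = \int[mu]_(x in A) (r x)%:E].

Lemma measurable_funV_ge0 r : measurable_fun [set: T] r ->
  (forall x, (0 <= r x)%R) -> measurable_fun [set: T] (fun x => (r x)^-1)%R.
Proof.
move=> mr r0; rewrite (_ : (fun _ => _) = (@powR R ^~ (-1)%R) \o r); last first.
  by apply/funext => x /=; rewrite powR_inv1.
by apply: measurableT_comp => //; exact: measurable_powR.
Qed.

Lemma integral_EFin_cst mu (c : R) : \int[mu]_x c%:E = c%:E.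
Proof.
rewrite (_ : (fun _ => _) = cst c%:E)// integral_cst//.
by rewrite [X in _ * X]probability_setT mule1.
Qed.

Lemma density_exists eta mu : eta `<< mu -> exists r, density_of eta mu r.
Proof.
move=> etamu; pose f := Radon_Nikodym_SigmaFinite.f eta mu.
have fi := Radon_Nikodym_SigmaFinite.f_integrable etamu.
exists (fine \o f); split.
- apply: measurableT_comp; [exact: fine_measurable|exact: measurable_int fi].
- by move=> x; rewrite /= fine_ge0// Radon_Nikodym_SigmaFinite.f_ge0.
- move=> A mA; rewrite (Radon_Nikodym_SigmaFinite.f_integral etamu mA).
  by apply: eq_integral => x _; rewrite /= fineK// Radon_Nikodym_SigmaFinite.f_fin_num.
Qed.

Lemma density_dominates eta mu r : density_of eta mu r -> eta `<< mu.
Proof.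
move=> [mr r0 etaE]; apply/null_content_dominatesP => A mA muA.
rewrite etaE//; apply: null_set_integral => //.
by apply/measurable_funTS/measurable_EFinP.
Qed.

Lemma density_integrable eta mu r : density_of eta mu r ->
  mu.-integrable [set: T] (EFin \o r).
Proof.
move=> [mr r0 etaE]; apply/integrableP; split; first exact/measurable_EFinP.
under eq_integral do rewrite /= ger0_norm//.
by rewrite -etaE// probability_setT ltry.
Qed.

Lemma density_ae_eq eta mu r (f : T -> \bar R) : density_of eta mu r ->
  measurable_fun [set: T] f ->
  (forall A, measurable A -> eta A = \int[mu]_(x in A) f x) ->
  {ae mu, forall x, (r x)%:E = f x}.
Proof.
move=> dr mf fE; have [mr r0 etaE] := dr.
have : ae_eq mu [set: T] (EFin \o r) f.
  apply: integral_ae_eq => //; first exact: density_integrable dr.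
  by move=> A _ mA; rewrite -etaE// fE.
by apply: filterS => x; exact.
Qed.

Lemma density_integral eta mu r (f : T -> \bar R) A : density_of eta mu r ->
  measurable A -> (forall x, 0 <= f x) -> measurable_fun [set: T] f ->
  \int[eta]_(x in A) f x = \int[mu]_(x in A) (f x * (r x)%:E).
Proof.
move=> dr mA f0 mf; have [mr r0 etaE] := dr.
have etamu := density_dominates dr.
rewrite -(Radon_Nikodym_SigmaFinite.change_of_variables etamu)//; last exact: measurable_funTS.
have fi := Radon_Nikodym_SigmaFinite.f_integrable etamu.
apply: ae_eq_integral => //.
- apply: emeasurable_funM; apply: measurable_funTS => //; exact: measurable_int fi.
- apply: emeasurable_funM; apply: measurable_funTS => //; exact/measurable_EFinP.
- have := density_ae_eq dr (measurable_int _ fi)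
    (Radon_Nikodym_SigmaFinite.f_integral etamu).
  by apply: filterS => x -> _.
Qed.

Lemma density_gt0 eta mu r : density_of eta mu r ->
  {ae eta, forall x, (0 < r x)%R}.
Proof.
move=> dr; have [mr r0 etaE] := dr; exists (r @^-1` [set 0%R]); split.
- by rewrite -[X in measurable X]setTI; exact: mr.
- rewrite etaE; last by rewrite -[X in measurable X]setTI; exact: mr.
  by apply: integral0_eq => x ->.
- by move=> x /= /negP; rewrite -leNgt => rx; apply/eqP; rewrite eq_le rx r0.
Qed.

Lemma Ent_density eta mu r : density_of eta mu r ->
  Ent eta mu = \int[eta]_x (ln (r x))%:E.
Proof.
move=> dr; have [mr r0 etaE] := dr; have etamu := density_dominates dr.
rewrite /Ent asboolT//; set f := Radon_Nikodym _ mu.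
have ff x : f x \is a fin_num by exact: Radon_Nikodym_fin_num.
have mf : measurable_fun [set: T] f.
  by apply: (measurable_int mu); exact: Radon_Nikodym_integrable.
have mff : measurable_fun [set: T] (fine \o f).
  by apply: measurableT_comp => //; exact: fine_measurable.
apply: ae_eq_integral => //.
- rewrite (_ : (fun x => _) = (fun x => if (fine (f x) <= 0)%R then -oo
      else (ln (fine (f x)))%:E)); last first.
    by apply/funext => x; rewrite -[in LHS](fineK (ff x)).
  apply: measurable_fun_ifT => //; first exact: measurable_fun_ler.
  apply/measurable_EFinP; by apply: measurableT_comp => //; exact: measurable_ln.
- apply/measurable_EFinP; by apply: measurableT_comp => //; exact: measurable_ln.
- have rf : ae_eq mu [set: T] (EFin \o r) f.
    have := density_ae_eq dr mf (fun A mA =>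
      @Radon_Nikodym_integral _ _ _ (charge_of_finite_measure eta) mu A etamu mA).
    by apply: filterS => x + _; exact.
  have := null_dominates_ae_eq measurableT etamu rf.
  have := density_gt0 dr; apply: filterS2 => x rx /(_ I) /= <- _.
  by rewrite lne_EFin.
Qed.

(** Equality may fail: where [r] vanishes the quotient is 0 and [eta] does not
    see [u]. *)
Lemma density_integral_div eta mu r u : density_of eta mu r ->
  measurable_fun [set: T] u -> (forall x, (0 <= u x)%R) ->
  \int[eta]_x (u x / r x)%:E <= \int[mu]_x (u x)%:E.
Proof.
move=> dr mu' u0; have [mr r0 etaE] := dr.
have m1 : measurable_fun [set: T] (fun x => u x / r x)%R.
  by apply: measurable_funM => //; exact: measurable_funV_ge0.
rewrite (density_integral dr)//; last 2 first.
- by move=> x; rewrite lee_fin divr_ge0.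
- exact/measurable_EFinP.
apply: ge0_le_integral => //.
- by move=> x _; rewrite -EFinM lee_fin mulr_ge0// divr_ge0.
- by apply/measurable_EFinP; exact: measurable_funM.
- exact/measurable_EFinP.
- move=> x _; rewrite -EFinM lee_fin.
  have [->|rx] := eqVneq (r x) 0%R; first by rewrite mulr0.
  by rewrite divfK.
Qed.

Lemma ln_le_subr1 (x : R) : (0 < x -> ln x <= x - 1)%R.
Proof.
move=> x0; have := @le_ln1Dx R (x - 1); rewrite addrCA subrr addr0; apply.
lra.
Qed.

Lemma measurable_fun_ln r : measurable_fun [set: T] r ->
  measurable_fun [set: T] (fun x => ln (r x)).
Proof. by move=> mr; apply: measurableT_comp => //; exact: measurable_ln. Qed.

(** The negative part of [ln r] is at most [1 / r], whose integral against
    [r mu] is at most the total mass of [mu]. *)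
Lemma density_neg_integrable eta mu r : density_of eta mu r ->
  neg_integrable eta (fun x => ln (r x)).
Proof.
move=> dr; have [mr r0 etaE] := dr.
have mr' := measurable_funV_ge0 mr r0.
have : \int[eta]_x (1 / r x)%:E <= 1.
  apply: le_trans (density_integral_div dr _ _) _ => //.
  by rewrite (integral_EFin_cst mu 1).
have := density_gt0 dr => rgt0 i1.
apply: le_lt_trans (le_lt_trans i1 (ltry _)).
apply: ae_ge0_le_integral => //.
- by apply/measurable_funeneg/measurable_EFinP; exact: measurable_fun_ln.
- by move=> x _; rewrite lee_fin mul1r invr_ge0.
- by apply/measurable_EFinP; under eq_fun do rewrite mul1r.
- apply: filterS rgt0 => x rx _; rewrite funenegE /= mul1r.
  rewrite ge_max !lee_fin invr_ge0 r0 andbT -lnV//.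
  by apply: le_trans (ln_le_subr1 _) _; rewrite ?invr_gt0// gerBl.
Qed.

Lemma Ent_gtNy eta mu : -oo < Ent eta mu.
Proof.
have [etamu|netamu] := pselect (eta `<< mu); last by rewrite /Ent asboolF.
have [r dr] := density_exists etamu; rewrite (Ent_density dr).
apply: neg_integral_gtNy (density_neg_integrable dr).
by apply: measurable_fun_ln; case: dr.
Qed.

Lemma Ent_lty_dominates eta mu : Ent eta mu < +oo -> eta `<< mu.
Proof. by rewrite /Ent; case: asboolP. Qed.

(** Integrate [ln s <= ln r + (s / r - 1)] against [eta = r mu]. The function
    [s] need not have mass 1, which gives one bound for densities and for
    densities multiplied by a test function. *)
Lemma Gibbs eta mu r s : density_of eta mu r -> measurable_fun [set: T] s ->
  (forall x, (0 <= s x)%R) -> {ae eta, forall x, (0 < s x)%R} ->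
  \int[mu]_x (s x)%:E < +oo ->
  \int[eta]_x (ln (s x))%:E <= Ent eta mu + (\int[mu]_x (s x)%:E - 1).
Proof.
move=> dr ms s0 sgt0 sy; have [mr r0 etaE] := dr; rewrite (Ent_density dr).
have ssr := density_integral_div dr ms s0.
have msr : measurable_fun [set: T] (fun x => s x / r x)%R.
  by apply: measurable_funM => //; exact: measurable_funV_ge0.
have sri : eta.-integrable [set: T] (EFin \o (fun x => s x / r x)%R).
  apply/integrableP; split; first exact/measurable_EFinP.
  under eq_integral do rewrite /= ger0_norm ?divr_ge0//.
  exact: le_lt_trans sy.
have ci : eta.-integrable [set: T] (EFin \o cst (-1)%R).
  exact: finite_measure_integrable_cst.
apply: (@le_trans _ _ (\int[eta]_x (ln (r x) + (s x / r x + cst (-1)%R x))%:E)).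
  apply: ae_le_integral.
  - exact: measurable_fun_ln.
  - by apply: measurable_funD; [exact: measurable_fun_ln|exact: measurable_funD].
  - have := density_gt0 dr; apply: filterS2 sgt0 => x sx rx.
    rewrite -[in X in (X <= _)%R](divfK (lt0r_neq0 rx) (s x)) mulrC.
    by rewrite lnM ?posrE ?divr_gt0// lerD2l ln_le_subr1// divr_gt0.
rewrite neg_integralD; [|exact: measurable_fun_ln|exact: density_neg_integrable dr|].
  rewrite leeD2l//; under eq_integral do rewrite EFinD.
  rewrite integralD//; apply: leeD => //.
  by rewrite (integral_EFin_cst eta (-1)).
rewrite (_ : EFin \o _ =
  (EFin \o (fun x => s x / r x)%R) \+ (EFin \o cst (-1)%R)) //.
exact: integrableD.
Qed.

Lemma Gibbs_prob eta mu r s : density_of eta mu r -> measurable_fun [set: T] s ->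
  (forall x, (0 <= s x)%R) -> {ae eta, forall x, (0 < s x)%R} ->
  \int[mu]_x (s x)%:E <= 1 ->
  \int[eta]_x (ln (s x))%:E <= Ent eta mu.
Proof.
move=> dr ms s0 sgt0 s1.
apply: le_trans (Gibbs dr ms s0 sgt0 (le_lt_trans s1 (ltry _))) _.
by rewrite -[leRHS]adde0 leeD2l// sube_le0.
Qed.

Lemma probability_of_density mu s : measurable_fun [set: T] s ->
  (forall x, (0 <= s x)%R) -> \int[mu]_x (s x)%:E = 1 ->
  exists eta, density_of eta mu s.
Proof.
move=> ms s0 s1; pose nu A := \int[mu]_(x in A) (s x)%:E.
have nu0 : nu set0 = 0 by rewrite /nu integral_set0.
have nuge0 A : 0 <= nu A by apply: integral_ge0 => x _; rewrite lee_fin.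
have nusa : semi_sigma_additive nu.
  apply: semi_sigma_additive_nng_induced; last by move=> x; rewrite lee_fin.
  exact/measurable_EFinP.
pose numeas : {measure set T -> \bar R} :=
  HB.pack nu (isMeasure.Build _ _ _ nu nu0 nuge0 nusa).
pose nuprob : probability T R :=
  HB.pack nu (Measure.class numeas) (Measure_isProbability.Build _ _ _ numeas s1).
by exists nuprob; split.
Qed.

End density.

(** * Image laws and the density of the minimizer *)

Section image_measure.
Context {R : realType} {dE dF : measure_display}.
Context {E : measurableType dE} {F : measurableType dF}.
Implicit Types (P mu nu : probability E R) (T : {mfun E >-> F}).

Lemma integral_distribution_real P T (f : F -> R) :
  measurable_fun [set: F] f ->
  \int[distribution P T]_y (f y)%:E = \int[P]_x (f (T x))%:E.
Proof.
move=> /measurable_EFinP mf; rewrite integralE [RHS]integralE.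
have mp := measurable_funepos mf; have mn := measurable_funeneg mf.
congr (_ - _).
  rewrite (ge0_integral_distribution T mp (funepos_ge0 _)).
  by apply: eq_integral => x _; rewrite /= !funeposE.
rewrite (ge0_integral_distribution T mn (funeneg_ge0 _)).
by apply: eq_integral => x _; rewrite /= !funenegE.
Qed.

Lemma ae_distribution P T (Q : F -> Prop) :
  {ae distribution P T, forall y, Q y} -> {ae P, forall x, Q (T x)}.
Proof.
move=> [N [mN N0 QN]]; exists (T @^-1` N); split => //.
  exact: measurable_funPTI.
by move=> x /= Qx; exact: QN.
Qed.

Lemma distribution_dominates mu nu T : mu `<< nu ->
  distribution mu T `<< distribution nu T.
Proof.
move=> /null_content_dominatesP munu; apply/null_content_dominatesP => A mA.
apply: munu; exact: measurable_funPTI.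
Qed.

End image_measure.

Section same_distribution.
Context {R : realType} {d : measure_display} {E : measurableType d}.
Implicit Types (P mu nu : probability E R).

Lemma same_distribution_integral mu nu (f : E -> \bar R) :
  same_distribution mu nu -> \int[mu]_x f x = \int[nu]_x f x.
Proof.
by move=> munu; apply: eq_measure_integral => A mA _; exact: munu.
Qed.

Lemma same_distribution_density mu nu P r :
  same_distribution mu nu -> density_of mu P r -> density_of nu P r.
Proof.
by move=> munu [mr r0 muE]; split => // A mA; rewrite -munu// muE.
Qed.

End same_distribution.

Section minimizer.
Context {R : realType} {dE dF : measure_display}.
Context {E : measurableType dE} {F : measurableType dF}.
Variables (pi : probability E R) (T : {mfun E >-> F}).

(** The image law can be adjusted without touching the conditional laws given
    [T]. *)
Lemma reweight_image (M : probability F R) g :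
  density_of M (distribution pi T) g ->
  exists2 nu, density_of nu pi (g \o T) & same_distribution (distribution nu T) M.
Proof.
move=> [mg g0 ME].
have mgT : measurable_fun [set: E] (g \o T) by exact: measurableT_comp.
have [x||nu dnu] := @probability_of_density _ _ _ pi _ mgT.
- exact: g0.
- have := integral_distribution_real pi T mg.
  by rewrite -ME// probability_setT => <-.
exists nu => // V mV; have [_ _ nuE] := dnu.
rewrite -[LHS]/(nu (T @^-1` V)) nuE; last first.
  exact: measurable_funPTI.
rewrite ME// ge0_integral_pushforward//.
  by apply/measurable_EFinP; exact: measurable_funTS.
by move=> y _; rewrite lee_fin.
Qed.

(** The reweighting of [pi] by the density [g] of the image law of [mustar] has
    the same image law as [mustar], and by Gibbs' inequality at most its
    entropy; uniqueness of the minimizer identifies the two. *)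
Lemma minimizer_density CT (mustar : probability E R) :
  distribution_set CT ->
  is_unique_entropy_minimizer (constraint_set T CT) pi mustar ->
  Ent mustar pi < +oo ->
  exists g : F -> R, [/\ measurable_fun [set: F] g, forall t, (0 <= g t)%R &
    density_of mustar pi (g \o T)].
Proof.
move=> CTs [CTmu minmu] /Ent_lty_dominates mupi.
have [r dr] := density_exists mupi.
have [g dg] := density_exists (distribution_dominates (T := T) mupi).
have [nu dnu nuM] := reweight_image dg.
have [mg g0 _] := dg; exists g; split => //.
have CTnu : constraint_set T CT nu.
  by apply: CTs CTmu => V mV; rewrite nuM.
have [munu] := minmu nu CTnu.
have -> : Ent nu pi = Ent mustar pi; last first.
  by move=> /(_ erefl) /same_distribution_density; apply.
apply/eqP; rewrite eq_le munu andbT (Ent_density dnu).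
have mlg := measurable_fun_ln mg.
rewrite -(integral_distribution_real nu T mlg) (same_distribution_integral _ nuM).
rewrite integral_distribution_real//; apply: (Gibbs_prob dr) => //.
- exact: measurableT_comp.
- exact: ae_distribution (density_gt0 dg).
- by have [_ _ <-] := dnu; rewrite ?probability_setT.
Qed.

End minimizer.

(** * Mixtures and the Pythagorean inequality *)

Section mixture.
Context {R : realType} {d : measure_display} {E : measurableType d}.
Implicit Types (eta mu nu : probability E R) (p q : R).

Lemma mixture_integral eta mu nu p q (f : E -> \bar R) :
  (0 <= p)%R -> (0 <= q)%R ->
  (forall A, measurable A -> eta A = p%:E * mu A + q%:E * nu A) ->
  measurable_fun [set: E] f -> (forall x, 0 <= f x) ->
  \int[eta]_x f x = p%:E * \int[mu]_x f x + q%:E * \int[nu]_x f x.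
Proof.
move=> p0 q0 etaE mf f0.
rewrite (eq_measure_integral
  (measure_add (mscale (NngNum p0) mu) (mscale (NngNum q0) nu))).
  by rewrite ge0_integral_measure_add// !ge0_integral_mscale.
by move=> A mA _; rewrite [RHS]measure_addE; exact: etaE.
Qed.

Lemma mixture_neg_integrable eta mu nu p q (f : E -> R) :
  (0 < p)%R -> (0 <= q)%R ->
  (forall A, measurable A -> eta A = p%:E * mu A + q%:E * nu A) ->
  measurable_fun [set: E] f -> neg_integrable eta f -> neg_integrable mu f.
Proof.
move=> p0 q0 etaE /measurable_EFinP mf; rewrite /neg_integrable.
rewrite (mixture_integral (ltW p0) q0 etaE)//; last exact: measurable_funeneg.
have : 0 <= \int[mu]_x (EFin \o f)^\- x by exact: integral_ge0.
have : 0 <= \int[nu]_x (EFin \o f)^\- x by exact: integral_ge0.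
move: (integral mu _ _) (integral nu _ _) => [a| |] [b| |] //=.
- by move=> *; rewrite ltry.
- by move=> *; rewrite ltry.
- by move=> _ _; rewrite gt0_muley ?lte_fin.
- move=> _ _; rewrite gt0_muley ?lte_fin//.
  by have [->|q1] := eqVneq q 0%R; [rewrite mul0e|rewrite gt0_muley// lte_fin lt0r q1].
Qed.

(** The positive parts may have infinite integrals; the negative parts do not,
    so that the differences recombine. *)
Lemma mixture_integral_real eta mu nu p q (f : E -> R) :
  (0 < p)%R -> (0 < q)%R ->
  (forall A, measurable A -> eta A = p%:E * mu A + q%:E * nu A) ->
  measurable_fun [set: E] f -> neg_integrable eta f ->
  \int[eta]_x (f x)%:E =
    p%:E * \int[mu]_x (f x)%:E + q%:E * \int[nu]_x (f x)%:E.
Proof.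
move=> p0 q0 etaE mf nf.
have etaE' A : measurable A -> eta A = q%:E * nu A + p%:E * mu A.
  by move=> mA; rewrite addeC etaE.
have n0 := mixture_neg_integrable p0 (ltW q0) etaE mf nf.
have n1 := mixture_neg_integrable q0 (ltW p0) etaE' mf nf.
have /measurable_EFinP mEf := mf.
rewrite !(integralE _ _ (fun x => (f x)%:E)).
rewrite !(mixture_integral (ltW p0) (ltW q0) etaE)//;
  [|exact: measurable_funeneg|exact: measurable_funepos].
have n0f : \int[mu]_x (EFin \o f)^\- x \is a fin_num.
  by rewrite ge0_fin_numE//; exact: integral_ge0.
have n1f : \int[nu]_x (EFin \o f)^\- x \is a fin_num.
  by rewrite ge0_fin_numE//; exact: integral_ge0.
have comb (a b c e : \bar R) : c \is a fin_num -> e \is a fin_num ->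
    (p%:E * a + q%:E * b) - (p%:E * c + q%:E * e) =
    p%:E * (a - c) + q%:E * (b - e).
  move=> cf ef; rewrite !muleBr ?fin_num_adde_defl ?fin_numN//.
  by rewrite [- (_ + _)]fin_num_oppeD ?fin_numM// addeACA.
exact: comb.
Qed.

End mixture.

Section truncation.
Context {R : realType} {d : measure_display} {T : measurableType d}.
Variable mu : probability T R.

Lemma neg_integrable_min (f : T -> R) (n : nat) :
  measurable_fun [set: T] f -> neg_integrable mu f ->
  mu.-integrable [set: T] (EFin \o (fun x => Num.min (f x) n%:R)).
Proof.
move=> mf nf.
have mm : measurable_fun [set: T] (fun x => Num.min (f x) n%:R).
  exact: measurable_minr.
apply: neg_integrable_fin => //.
  apply: le_lt_trans nf; apply: ge0_le_integral => //.
  - by apply: measurable_funeneg; exact/measurable_EFinP.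
  - by apply: measurable_funeneg; exact/measurable_EFinP.
  - move=> x _; rewrite !funenegE /= /maxe /Num.min !lte_fin.
    have n0 : (0 <= n%:R :> R)%R by [].
    by case: ifPn; case: ifPn; case: ifPn; rewrite ?lee_fin//=; lra.
apply: (@le_lt_trans _ _ (\int[mu]_x (n%:R)%:E)).
  by apply: ae_le_integral => //; apply: aeW => x; rewrite ge_min lexx orbT.
by rewrite integral_EFin_cst ltry.
Qed.

(** Monotone convergence for the positive part; the negative part is the same
    for all the truncations. *)
Lemma integral_le_of_truncations (f : T -> R) (c : R) :
  measurable_fun [set: T] f -> neg_integrable mu f ->
  (forall n : nat, \int[mu]_x (Num.min (f x) n%:R)%:E <= c%:E) ->
  \int[mu]_x (f x)%:E <= c%:E.
Proof.
move=> mf nf fc; have /measurable_EFinP mEf := mf.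
pose N := \int[mu]_x ((EFin \o f)^\- x).
have Nfin : N \is a fin_num by rewrite ge0_fin_numE//; exact: integral_ge0.
have n0 (n : nat) : (0 <= n%:R :> R)%R by [].
pose fp n x := mine ((EFin \o f)^\+ x) (n%:R)%:E.
have mfp n : measurable_fun [set: T] (fp n).
  by apply: measurable_mine => //; exact: measurable_funepos.
rewrite integralE leeBlDr//.
have -> : \int[mu]_x ((EFin \o f)^\+ x) = limn (fun n => \int[mu]_x fp n x).
  rewrite -monotone_convergence//.
  - apply: eq_integral => x _; apply/esym/cvg_lim => //.
    apply: cvg_near_cst; near=> n; rewrite /fp funeposE /=.
    apply/min_idPl; rewrite ge_max !lee_fin n0 andbT.
    near: n; exact: nbhs_infty_ger.
  - by move=> n x _; rewrite /fp le_min funepos_ge0 lee_fin n0.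
  - move=> x _ m n mn; rewrite /fp le_min ge_min lexx /= ge_min.
    by rewrite [X in _ || X]lee_fin ler_nat mn orbT.
apply: lime_le.
  apply: ereal_nondecreasing_is_cvgn => m n mn; apply: ge0_le_integral => //.
  - by move=> x _; rewrite /fp le_min funepos_ge0 lee_fin n0.
  - move=> x _; rewrite /fp le_min ge_min lexx /= ge_min.
    by rewrite [X in _ || X]lee_fin ler_nat mn orbT.
apply: nearW => n; move: (fc n).
rewrite (integralE _ _ (fun x => (Num.min (f x) n%:R)%:E)).
have mm : measurable_fun [set: T] (EFin \o (fun x => Num.min (f x) n%:R)).
  by apply/measurable_EFinP; exact: measurable_minr.
have pe : \int[mu]_x fp n x =
    \int[mu]_x ((EFin \o (fun x => Num.min (f x) n%:R))^\+ x).
  apply: eq_integral => x _; rewrite /fp !funeposE /=.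
  have := n0 n; rewrite /mine /maxe /Num.min !lte_fin.
  by repeat case: ifPn; rewrite ?lte_fin => //; intros; congr EFin; lra.
have ne : N = \int[mu]_x ((EFin \o (fun x => Num.min (f x) n%:R))^\- x).
  apply: eq_integral => x _; rewrite !funenegE /=.
  have := n0 n; rewrite /maxe /Num.min !lte_fin.
  by repeat case: ifPn; rewrite ?lte_fin => //; intros; congr EFin; lra.
by rewrite pe -leeBlDr// -[X in _ -> is_true (_ - X <= _)]/N ne.
Unshelve. all: by end_near. Qed.

End truncation.

Section pythagoras.
Context {R : realType} {d : measure_display} {E : measurableType d}.
Implicit Types (pi mu eta nu : probability E R).

Lemma mixture_exists pi mu nu r s (p q : R) :
  (0 <= p)%R -> (0 <= q)%R -> (p + q = 1)%R ->
  density_of mu pi r -> density_of nu pi s ->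
  exists zeta, density_of zeta pi (fun x => p * r x + q * s x)%R /\
    forall A, measurable A -> zeta A = p%:E * mu A + q%:E * nu A.
Proof.
move=> p0 q0 pq [mr r0 muE] [ms s0 nuE].
have mt : measurable_fun [set: E] (fun x => p * r x + q * s x)%R.
  by apply: measurable_funD; exact: measurable_funM.
have tE A : measurable A -> \int[pi]_(x in A) (p * r x + q * s x)%:E =
    p%:E * mu A + q%:E * nu A.
  move=> mA; under eq_integral do rewrite EFinD !EFinM.
  rewrite ge0_integralD//=; last 4 first.
  - by move=> x _; rewrite -EFinM lee_fin mulr_ge0.
  - by apply: measurable_funTS; apply/measurable_EFinP; exact: measurable_funM.
  - by move=> x _; rewrite -EFinM lee_fin mulr_ge0.
  - by apply: measurable_funTS; apply/measurable_EFinP; exact: measurable_funM.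
  rewrite !ge0_integralZl_EFin// ?muE ?nuE//.
  - by move=> x _; rewrite lee_fin.
  - by apply/measurable_EFinP; exact: measurable_funTS.
  - by move=> x _; rewrite lee_fin.
  - by apply/measurable_EFinP; exact: measurable_funTS.
have [x||zeta dz] := @probability_of_density _ _ _ pi _ mt.
- by rewrite addr_ge0// mulr_ge0.
- by rewrite tE// !probability_setT !mule1 -EFinD pq.
- exists zeta; split => // A mA; have [_ _ ->//] := dz; exact: tE.
Qed.

(** Perturb [mu] to [zeta = p eta + (1 - p) mu], with [pi]-density [t]. By
    minimality [Ent mu pi] is at most [Ent zeta pi], the average of the
    integrals of [ln t] under [eta] and [mu]; Gibbs' inequality bounds the second
    one by [Ent mu pi], so the first one is at least [Ent mu pi], while Gibbs'
    inequality for [eta] and the function [u t] bounds it above. Then [p] tends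
    to 0. The function [u] stands for a truncation of the density of [eta] with
    respect to [mu], bounded so that its integral under [eta] is finite. *)
Lemma pythagoras_test (S : set (probability E R)) pi mu eta (u : E -> R) (b : R) :
  convex_distribution_set S -> S mu -> S eta ->
  (forall nu, S nu -> Ent mu pi <= Ent nu pi) ->
  Ent mu pi < +oo -> Ent eta pi < +oo ->
  measurable_fun [set: E] u -> (forall x, (0 <= u x <= b)%R) ->
  {ae eta, forall x, (0 < u x)%R} ->
  eta.-integrable [set: E] (EFin \o (fun x => ln (u x))) ->
  \int[mu]_x (u x)%:E <= 1 ->
  \int[eta]_x (ln (u x))%:E + Ent mu pi <= Ent eta pi.
Proof.
move=> Sconv Smu Seta mumin muy etay meu ub ugt0 lnui umu.
have [s ds] := density_exists (Ent_lty_dominates muy).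
have [r dr] := density_exists (Ent_lty_dominates etay).
have [mr r0 etaE] := dr; have [ms s0 muE] := ds.
have mufin : Ent mu pi \is a fin_num by rewrite fin_numE gt_eqF ?Ent_gtNy ?lt_eqF.
have etafin : Ent eta pi \is a fin_num by rewrite fin_numE gt_eqF ?Ent_gtNy ?lt_eqF.
have b0 : (0 <= b)%R by have /andP[] := ub point; exact: le_trans.
have intub nu : \int[nu]_x (u x)%:E <= b%:E.
  rewrite -(integral_EFin_cst nu b); apply: ae_le_integral => //.
  by apply: aeW => x; have /andP[] := ub x.
have intu0 nu : 0 <= \int[nu]_x (u x)%:E.
  by apply: integral_ge0 => x _; rewrite lee_fin; have /andP[] := ub x.
have Lfin := integrable_fin_num measurableT lnui.
suff H (p : R) : (0 < p < 1)%R ->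
    \int[eta]_x (ln (u x))%:E + Ent mu pi <= Ent eta pi + p%:E * b%:E.
  apply/lee_addgt0Pr => e e0.
  (* the error term [p * b] has to be at most [e] *)
  pose p := Num.min (1 / 2)%R (e / (b + 1))%R.
  have p01 : (0 < p < 1)%R.
    rewrite /p lt_min gt_min divr_gt0// divr_gt0//; last lra.
    by apply/andP; split => //; apply/orP; left; lra.
  apply: le_trans (H p p01) _; rewrite leeD2l// -EFinM lee_fin.
  apply: (@le_trans _ _ (e / (b + 1) * b)%R).
    by rewrite ler_wpM2r// /p ge_min lexx orbT.
  by rewrite mulrAC ler_pdivrMr; [nra|lra].
move=> /andP[p0 p1].
have q0 : (0 < 1 - p)%R by lra.
have pq : (p + (1 - p) = 1)%R by ring.
have [z [dz zE]] := mixture_exists (ltW p0) (ltW q0) pq dr ds.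
set t := (fun x => _)%R in dz; have [mt t0 _] := dz.
have Sz : S z by apply: (Sconv p eta mu) => //; lra.
have nlt := density_neg_integrable dz.
have mlt := measurable_fun_ln mt.
have zEnt := mumin z Sz.
rewrite (Ent_density dz) (mixture_integral_real p0 q0 zE mlt nlt) in zEnt.
have rt : {ae eta, forall x, (0 < t x)%R}.
  apply: filterS (density_gt0 dr) => x rx; rewrite /t.
  by apply: ltr_pwDl; [exact: mulr_gt0|rewrite mulr_ge0// ltW].
have st : {ae mu, forall x, (0 < t x)%R}.
  apply: filterS (density_gt0 ds) => x sx; rewrite /t addrC.
  by apply: ltr_pwDl; [exact: mulr_gt0|rewrite mulr_ge0// ltW].
have Yle : \int[mu]_x (ln (t x))%:E <= Ent mu pi.
  by apply: (Gibbs_prob ds) => //; have [_ _ <-] := dz; rewrite ?probability_setT.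
have mut : measurable_fun [set: E] (fun x => u x * t x)%R by exact: measurable_funM.
have ut0 x : (0 <= u x * t x)%R by have /andP[u0 _] := ub x; exact: mulr_ge0.
have utE : \int[pi]_x (u x * t x)%:E = \int[z]_x (u x)%:E.
  rewrite (density_integral dz)//; last exact/measurable_EFinP.
  by move=> x; rewrite lee_fin; have /andP[] := ub x.
have Xle : \int[eta]_x (ln (t x))%:E + \int[eta]_x (ln (u x))%:E <=
    Ent eta pi + (\int[z]_x (u x)%:E - 1).
  have nlt_eta : neg_integrable eta (fun x => ln (t x)).
    exact: (mixture_neg_integrable p0 (ltW q0) zE mlt nlt).
  rewrite -neg_integralD// -utE.
  rewrite (@ae_eq_integral_real _ _ _ eta _ (fun x => ln (u x * t x)%R)); last first.
  - by apply: filterS2 ugt0 rt => x ux tx; rewrite mulrC lnM.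
  - exact: measurable_fun_ln.
  - by apply: measurable_funD => //; exact: measurable_fun_ln.
  apply: (Gibbs dr) => //.
    by apply: filterS2 ugt0 rt => x ux tx; exact: mulr_gt0.
  by rewrite utE (le_lt_trans (intub z))// ltry.
have uz : \int[z]_x (u x)%:E =
    p%:E * \int[eta]_x (u x)%:E + (1 - p)%:E * \int[mu]_x (u x)%:E.
  apply: (mixture_integral (ltW p0) (ltW q0) zE).
    exact/measurable_EFinP.
  by move=> x; rewrite lee_fin; have /andP[] := ub x.
rewrite uz in Xle.
have Xny : -oo < \int[eta]_x (ln (t x))%:E.
  apply: neg_integral_gtNy => //.
  exact: (mixture_neg_integrable p0 (ltW q0) zE mlt nlt).
move: zEnt Yle Xle Xny mufin etafin Lfin (intub eta) (intu0 eta) (intu0 mu) umu.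
move: (Ent mu pi) (Ent eta pi) (\int[eta]_x (ln (u x))%:E) => [h| |]// [D| |]// [L| |]//.
move: (\int[eta]_x (ln (t x))%:E) (\int[mu]_x (ln (t x))%:E)
  (\int[eta]_x (u x)%:E) (\int[mu]_x (u x)%:E) => [X| |]// [Y| |]// [a| |]// [c| |]//;
  rewrite -?EFinN -?EFinM -?EFinD ?lee_fin.
- move=> h1 h2 h3 _ _ _ _ h4 h5 h6 h7.
  have hX : (h <= X)%R by nra.
  nra.
- by rewrite gt0_muleNy ?lte_fin.
Qed.

(** Where [s] vanishes the quotient [r / s] is 0 by convention, which is only
    correct if [eta] does not charge that set. *)
Lemma density_ratio pi mu eta r s : density_of eta pi r -> density_of mu pi s ->
  eta (s @^-1` [set 0%R]) = 0 -> density_of eta mu (fun x => r x / s x)%R.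
Proof.
move=> [mr r0 etaE] ds; have [ms s0 muE] := ds => Z0.
have mZ : measurable (s @^-1` [set 0%R]).
  by rewrite -[X in measurable X]setTI; exact: ms.
have mk : measurable_fun [set: E] (fun x => r x / s x)%R.
  by apply: measurable_funM => //; exact: measurable_funV_ge0.
have muZ : mu (s @^-1` [set 0%R]) = 0.
  by rewrite muE//; apply: integral0_eq => x ->.
split => // [x|A mA]; first exact: divr_ge0.
have mAZ : measurable (A `\` s @^-1` [set 0%R]) by exact: measurableD.
have -> : eta A = eta (A `\` s @^-1` [set 0%R]).
  rewrite measureD//; last by rewrite (le_lt_trans (probability_le1 _ _))// ltry.
  rewrite [X in _ - X](_ : _ = 0) ?sube0//; apply/eqP.
  by rewrite eq_le measure_ge0 andbT -Z0 le_measure ?inE//; exact: measurableI.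
rewrite (ge0_negligible_integral mZ)//; last 2 first.
- by apply/measurable_EFinP; exact: measurable_funTS.
- by move=> x _; rewrite lee_fin divr_ge0.
rewrite (density_integral ds)//; last 2 first.
- by move=> x; rewrite lee_fin divr_ge0.
- exact/measurable_EFinP.
rewrite etaE//; apply: eq_integral => x; rewrite inE => -[_ /= sx].
by rewrite -EFinM divfK//; apply/eqP.
Qed.

(** First [eta << mu]: with [u] equal to [exp n] on a [mu]-null set [Z] and to 1
    elsewhere, the test inequality reads [n * eta Z <= Ent eta pi - Ent mu pi]
    for all [n]. Then [u] can be taken to be the density of [eta] with respect
    to [mu] truncated at [exp n], and [n] sent to infinity. *)
Lemma pythagoras (S : set (probability E R)) pi mu eta :
  convex_distribution_set S -> S mu -> S eta ->
  (forall nu, S nu -> Ent mu pi <= Ent nu pi) ->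
  Ent mu pi < +oo -> Ent eta mu + Ent mu pi <= Ent eta pi.
Proof.
move=> Sconv Smu Seta mumin muy.
have [etay|] := ltP (Ent eta pi) +oo; last by rewrite leye_eq => /eqP ->; rewrite leey.
have [s ds] := density_exists (Ent_lty_dominates muy).
have [r dr] := density_exists (Ent_lty_dominates etay).
have [mr r0 etaE] := dr; have [ms s0 muE] := ds.
have mufin : Ent mu pi \is a fin_num by rewrite fin_numE gt_eqF ?Ent_gtNy ?lt_eqF.
have etafin : Ent eta pi \is a fin_num by rewrite fin_numE gt_eqF ?Ent_gtNy ?lt_eqF.
have test := pythagoras_test Sconv Smu Seta mumin muy etay.
pose Z := s @^-1` [set 0%R].
have mZ : measurable Z by rewrite -[X in measurable X]setTI; exact: ms.
have muZ : mu Z = 0 by rewrite muE//; apply: integral0_eq => x ->.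
have indZ x : (0 <= (\1_Z x : R) <= 1)%R by rewrite indicE; case: (_ \in _) => /=; lra.
have mindZ : measurable_fun [set: E] (\1_Z : E -> R) by exact: measurable_indic.
have iZ nu : \int[nu]_x (\1_Z x)%:E = nu Z by rewrite integral_indic// setIT.
have etaZ : eta Z = 0.
  have bound (n : nat) : n%:R%:E * eta Z + Ent mu pi <= Ent eta pi.
    have lnE x : ln (expR (n%:R * \1_Z x)) = (n%:R * \1_Z x)%R :> R.
      by rewrite expRK.
    have <- : \int[eta]_x (ln (expR (n%:R * \1_Z x)))%:E = n%:R%:E * eta Z.
      under eq_integral do rewrite lnE EFinM.
      rewrite ge0_integralZl_EFin//; first by rewrite iZ.
      exact/measurable_EFinP.
    apply: (test (fun x => expR (n%:R * \1_Z x)) (expR n%:R)).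
    - by apply: measurableT_comp; [exact: measurable_expR|exact: measurable_funM].
    - move=> x; rewrite expR_ge0 ler_expR.
      by rewrite ler_piMr//; have /andP[] := indZ x.
    - by apply: aeW => x; exact: expR_gt0.
    - rewrite (_ : EFin \o _ = (fun x => n%:R%:E * (\1_Z x)%:E)); last first.
        by apply/funext => x /=; rewrite lnE.
      apply: integrableZl => //; exact: integrable_indic.
    - rewrite -(integral_EFin_cst mu 1); apply: ae_le_integral => //.
        by apply: measurableT_comp; [exact: measurable_expR|exact: measurable_funM].
      exists Z; split => // x /= /negP; rewrite -ltNge indicE.
      case: (boolP (x \in Z)); rewrite ?inE//= mulr0 expR0; lra.
  have zfin : eta Z \is a fin_num by exact: fin_num_measure.
  have z0 : 0 <= eta Z by exact: measure_ge0.
  move: bound mufin etafin zfin z0.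
  move: (Ent mu pi) (Ent eta pi) (eta Z) => [h| |]// [D| |]// [z| |]//.
  rewrite lee_fin => bound _ _ _ z0; congr EFin; apply/eqP; rewrite eq_le z0 andbT.
  rewrite leNgt; apply/negP => zgt0.
  have := bound (Num.truncn ((D - h) / z)).+1.
  rewrite -EFinM -EFinD lee_fin leNgt => /negP; apply.
  rewrite -ltrBlDr -ltr_pdivrMr//.
  exact: truncnS_gt.
have dk := density_ratio dr ds etaZ.
set k := (fun x => _)%R in dk; have [mk k0 _] := dk.
have nlk := density_neg_integrable dk.
have mlk := measurable_fun_ln mk.
rewrite (Ent_density dk) -leeBrDr// -(fineK etafin) -(fineK mufin) -EFinB.
apply: integral_le_of_truncations => // n.
rewrite EFinB !fineK// leeBrDr//.
have kgt0 := density_gt0 dk.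
pose u x := Num.min (k x) (expR n%:R).
have mu_ : measurable_fun [set: E] u by exact: measurable_minr.
have lnu : {ae eta, forall x, Num.min (ln (k x)) n%:R = ln (u x)}.
  apply: filterS kgt0 => x kx; rewrite /u.
  have [h|h] := leP (k x) (expR n%:R).
    rewrite min_l// -(expRK n%:R) ler_ln ?posrE ?expR_gt0//.
  by rewrite min_r ?expRK// -{1}(expRK n%:R) ler_ln ?posrE ?expR_gt0// ltW.
have mmin : measurable_fun [set: E] (fun x => Num.min (ln (k x)) n%:R).
  exact: measurable_minr.
have mlu := measurable_fun_ln mu_.
rewrite (ae_eq_integral_real mmin mlu lnu).
apply: (test u (expR n%:R)) => //.
- by move=> x; rewrite /u le_min k0 expR_ge0 ge_min lexx orbT.
- by apply: filterS kgt0 => x kx; rewrite /u lt_min kx expR_gt0.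
- apply: ae_eq_integrable_real (neg_integrable_min n mlk nlk) => //.
- apply: (@le_trans _ _ (\int[mu]_x (k x)%:E)).
    by apply: ae_le_integral => //; apply: aeW => x; rewrite /u ge_min lexx.
  by have [_ _ <-] := dk; rewrite ?probability_setT.
Qed.

End pythagoras.

(** * Injective coding of points by real numbers *)

Section real_coding.
Context {R : realType} {d : measure_display} {E : measurableType d}.

(** Pull back a countable basis of the Polish model; in a Hausdorff space it
    separates points. *)
Lemma standard_borel_separating : standard_borel R E ->
  exists U : nat -> set E, (forall n, measurable (U n)) /\
    forall x y, (forall n, U n x <-> U n y) -> x = y.
Proof.
move=> [X [j [hX [B /countable_injP[f finj] [Bo Bb]] jb mE]]].
(* the basic open set with number [n], empty when there is none *)
pose U n := [set x | exists2 b, B b & f b = n /\ b (j x)].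
exists U; split.
  move=> n; have [[b [Bb' fb]]|nb] := pselect (exists b, B b /\ f b = n).
    apply/mE; exists b; first by apply: sub_sigma_algebra; exact: Bo.
    apply/seteqP; split => [x [c Bc [fc cx]]|x bx]; last by exists b.
    by rewrite /preimage/= -(finj c b) ?inE// fb fc.
  rewrite (_ : U n = set0)//; apply/seteqP; split => // x [b Bb' [fb _]].
  by case: nb; exists b.
move=> x y Uxy; apply: (bij_inj jb); apply: contrapT => /eqP jxy.
move: hX; rewrite open_hausdorff => /(_ _ _ jxy) [[V W] /= [xV yW] [oV oW /eqP VW]].
have [b [Bb' bx] bV] : exists2 b, B b /\ b (j x) & b `<=` V.
  apply: (Bb (j x)); rewrite nbhsE /=; exists V => //; split => //.
  by move: xV; rewrite inE.
have [c Bc [fc cy]] : U (f b) y by apply/Uxy; exists b.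
have cb : c = b by apply: finj; rewrite ?inE.
suff : (V `&` W) (j y) by rewrite VW.
by split; [apply: bV; rewrite -cb|move: yW; rewrite inE].
Qed.

(** Separating sets code points by the ternary expansion [sum 3^-n 1_(U n)]:
    digits 0 and 1 only, hence no two expansions coincide. *)
Lemma separating_real_injection (U : nat -> set E) :
  (forall n, measurable (U n)) ->
  (forall x y, (forall n, U n x <-> U n y) -> x = y) ->
  exists2 phi : E -> R, measurable_fun [set: E] phi & injective phi.
Proof.
move=> mU sepU; pose w n : R := (3^-1 ^+ n)%R.
have w0 n : (0 < w n)%R by rewrite exprn_gt0.
have wS n : (w n = 3 * w n.+1)%R by rewrite /w exprS mulrA divff ?mul1r.
pose a n x : R := \1_(U n) x.
have a01 n x : (0 <= a n x <= 1)%R.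
  by rewrite /a indicE; case: (_ \in _) => /=; lra.
pose S n x : R := (\sum_(0 <= k < n) a k x * w k)%R.
have SS n x : (S n.+1 x = S n x + a n x * w n)%R by rewrite /S big_nat_recr.
have ndS x : nondecreasing_seq (S ^~ x).
  apply/nondecreasing_seqP => n; rewrite SS lerDl.
  by apply: mulr_ge0; [have /andP[] := a01 n x|exact: ltW].
(* [3 / 2 * w n] is the sum of the weights of index at least [n] *)
have niS x : nonincreasing_seq (fun n => S n x + 3 / 2 * w n)%R.
  apply/nonincreasing_seqP => n; rewrite SS (wS n).
  by have /andP[_ ] := a01 n x; have := w0 n.+1; nra.
have tail x n m : (S m x <= S n x + 3 / 2 * w n)%R.
  have [nm|mn] := leqP n m.
    apply: le_trans (niS x _ _ nm); rewrite lerDl mulr_ge0 ?ltW//; lra.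
  apply: le_trans (ndS x _ _ (ltnW mn)) _; rewrite lerDl mulr_ge0 ?ltW//; lra.
have cS x : cvgn (S ^~ x).
  apply: nondecreasing_is_cvgn => //; exists (S 0%N x + 3 / 2 * w 0%N)%R.
  by move=> _ [n _ <-]; exact: tail.
pose phi x := limn (S ^~ x).
have phige n x : (S n x <= phi x)%R by exact: nondecreasing_cvgn_le.
have phile n x : (phi x <= S n x + 3 / 2 * w n)%R.
  by apply: limr_le => //; apply: nearW => m; exact: tail.
exists phi.
  apply: (@measurable_fun_cvg _ _ _ _ S phi); last by move=> x _; exact: cS.
  move=> n; apply: measurable_sum => k.
  by apply: measurable_funM => //; exact: measurable_indic.
have phiN x y n : (forall k, (k < n)%N -> (U k x <-> U k y)) -> U n x -> ~ U n y ->
    phi x <> phi y.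
  move=> lt_n Ux nUy.
  have Sxy : S n x = S n y.
    apply: eq_big_nat => k /andP[_ kn]; congr (_ * _)%R.
    rewrite /a !indicE; congr (nat_of_bool _)%:R.
    by apply/idP/idP; rewrite !inE; apply lt_n.
  have := phige n.+1 x; have := phile n.+1 y; rewrite !SS Sxy.
  have -> : a n x = 1%R by rewrite /a indicE mem_set.
  have -> : a n y = 0%R by rewrite /a indicE memNset.
  rewrite (wS n); have := w0 n.+1; lra.
move=> x y phixy; apply: sepU; apply: contrapT => /existsNP Nxy.
have Nxy' : exists n, ~~ `[< U n x <-> U n y >].
  by have [n h] := Nxy; exists n; apply/asboolPn.
case: (ex_minnP Nxy') => n /asboolPn nxy nmin.
have lt_n k : (k < n)%N -> U k x <-> U k y.
  move=> kn; apply: contrapT => h; have := nmin k; rewrite leqNgt kn.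
  by move=> /(_ _)/negP; apply => //; apply/asboolPn.
have [Ux|nUx] := pselect (U n x); have [Uy|nUy] := pselect (U n y).
- by apply: nxy.
- exact: (phiN x y n).
- by apply: (phiN y x n) => // k kn; split; apply lt_n.
- by apply: nxy; split.
Qed.

End real_coding.

(** * Quantiles of measures without atoms *)

Section downset.
Context {R : realType} {d : measure_display} {E : measurableType d}.

(** The sequence is constant when [S] has a maximum; otherwise it increases to
    the supremum of [S], or to infinity. *)
Lemma cofinal_sequence (S : set R) : (exists r, S r) ->
  (forall r s, S s -> (r <= s)%R -> S r) ->
  exists u : nat -> R, [/\ nondecreasing_seq u, forall n, S (u n) &
    forall s, S s -> exists n, (s <= u n)%R].
Proof.
move=> S0 Sdown; have [[c Sc maxc]|nomax] := pselect (exists2 c, S c & forall s, S s -> (s <= c)%R).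
  by exists (fun=> c); split => // s Ss; exists 0%N; exact: maxc.
have [ubS|nubS] := pselect (has_ubound S).
  have supS : has_sup S by split.
  have lt_sup s : S s -> (s < sup S)%R.
    move=> Ss; rewrite lt_neqAle ub_le_sup// andbT; apply/eqP => sE.
    by apply: nomax; exists s => // t St; rewrite sE; exact: ub_le_sup.
  exists (fun n => sup S - n.+1%:R^-1)%R; split.
  - move=> m n mn; rewrite lerD2l lerN2 lef_pV2 ?posrE ?ltr0n//.
    by rewrite ler_nat ltnS.
  - move=> n; have n0 : (0 < n.+1%:R^-1 :> R)%R by rewrite invr_gt0 ltr0n.
    have [s Ss /ltW] := sup_adherent n0 supS; exact: Sdown.
  - move=> s /lt_sup ssup; exists (Num.truncn (sup S - s)^-1).
    rewrite lerBrDr -lerBrDl; apply: ltW.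
    rewrite invf_plt ?posrE ?ltr0n ?subr_gt0//; exact: truncnS_gt.
exists (fun n => n%:R); split.
- by move=> m n mn; rewrite ler_nat.
- move=> n; apply: contrapT => Sn; apply: nubS; exists n%:R => s Ss.
  by rewrite leNgt; apply/negP => /ltW sn; apply: Sn; exact: Sdown Ss sn.
- by move=> s _; exists (Num.truncn s).+1; exact/ltW/truncnS_gt.
Qed.

Variables (m : {measure set E -> \bar R}) (phi : E -> R).
Hypothesis mphi : measurable_fun [set: E] phi.

Lemma measurable_sublevel (r : R) : measurable [set x | (phi x <= r)%R].
Proof.
rewrite -[X in measurable X]setTI (_ : [set x | _] = phi @^-1` `]-oo, r]%classic).
  exact: mphi.
by apply/seteqP; split => x /=; rewrite in_itv.
Qed.

(** A lower set of reals is an increasing union of closed half-lines. *)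
Lemma measure_downset_le (S : set R) (a : \bar R) : 0 <= a ->
  (forall r s, S s -> (r <= s)%R -> S r) ->
  (forall r, S r -> m [set x | (phi x <= r)%R] <= a) ->
  measurable (phi @^-1` S) /\ m (phi @^-1` S) <= a.
Proof.
move=> a0 Sdown Sa.
have [S0|nS] := pselect (exists r, S r); last first.
  rewrite (_ : phi @^-1` S = set0) ?measure0//.
  by apply/seteqP; split => // x Sx; apply: nS; exists (phi x).
have [u [ndu uS ucof]] := cofinal_sequence S0 Sdown.
pose G n := [set x | (phi x <= u n)%R].
have GE : phi @^-1` S = \bigcup_n G n.
  apply/seteqP; split => [x /ucof[n h]|x [n _ h]]; first by exists n.
  exact: Sdown (uS n) h.
have mG n : measurable (G n) by exact: measurable_sublevel.
have mUG : measurable (\bigcup_n G n) by exact: bigcupT_measurable.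
have ndG : nondecreasing_seq G.
  move=> k n kn; apply/subsetPset => x /= h; apply: le_trans h _; exact: ndu.
rewrite GE; split => //.
have cvgm : m \o G @ \oo --> m (\bigcup_n G n) by exact: nondecreasing_cvg_mu.
rewrite -(cvg_lim _ cvgm)//; apply: lime_le; first exact: cvgP cvgm.
by apply: nearW => n; exact: Sa.
Qed.

End downset.

Section quantile.
Context {R : realType} {d : measure_display} {E : measurableType d}.
Variables (m : {measure set E -> \bar R}) (phi : E -> R).
Hypothesis mphi : measurable_fun [set: E] phi.

(** When no fibre of [phi] is charged, the distribution function [F] of [phi]
    is continuous and [{F phi <= a}] has measure exactly [a]: bound this set and
    its complement from above, as a lower set and an upper set. *)
Lemma measure_quantile (a : R) : m [set: E] < +oo ->
  (forall r, m (phi @^-1` [set r]) = 0) ->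
  0 <= a%:E -> a%:E <= m [set: E] ->
  m [set x | m [set y | (phi y <= phi x)%R] <= a%:E] = a%:E.
Proof.
move=> my fib a0 aM.
have mfin A : measurable A -> m A \is a fin_num.
  by move=> mA; rewrite ge0_fin_numE// (le_lt_trans _ my)// le_measure ?inE.
pose F r := m [set y | (phi y <= r)%R].
have mC A : measurable A -> m (~` A) = m [set: E] - m A.
  by move=> mA; rewrite -setTD measureD// setTI.
have ndF r s : (r <= s)%R -> F r <= F s.
  move=> rs; apply: le_measure; rewrite ?inE; [exact: measurable_sublevel..|].
  by move=> x /= /le_trans; apply.
pose S := [set r | F r <= a%:E].
have Sdown r s : S s -> (r <= s)%R -> S r.
  by rewrite /S /= => + /ndF h => /(le_trans h).
have [mS leS] := measure_downset_le (m := m) mphi a0 Sdown (fun r Sr => Sr).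
apply/eqP; rewrite eq_le leS /=.
pose S' := [set r | ~ S (- r)%R].
have mphi' : measurable_fun [set: E] (fun x => - phi x)%R by exact: measurable_funN.
have [] := @measure_downset_le _ _ _ m _ mphi' S' (m [set: E] - a%:E).
- by rewrite sube_ge0.
- by rewrite /S' /= => r s nSs rs Sr; apply: nSs; apply: Sdown Sr _; rewrite lerN2.
- move=> r; rewrite /S' /S /= => /negP; rewrite -ltNge => /ltW aF.
  rewrite (_ : [set x | _] = ~` [set x | (phi x <= - r)%R] `|` phi @^-1` [set (- r)%R]).
    apply: le_trans (measureU2 _ _ _) _.
    + by apply: measurableC; exact: measurable_sublevel.
    + by rewrite -[X in measurable X]setTI; exact: mphi.
    rewrite [X in _ + X <= _]fib adde0.
    rewrite [leLHS](_ : _ = m [set: E] - F (- r)%R); first by rewrite EFinN leeB.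
    by apply: mC; exact: measurable_sublevel.
  apply/seteqP; split => x /=.
    by rewrite lerNl le_eqVlt => /orP[/eqP ->|h]; [right|left; apply/negP; rewrite -ltNge].
  by rewrite lerNl => -[/negP|->//]; rewrite -ltNge => /ltW.
- rewrite (_ : (fun x => - phi x)%R @^-1` S' = ~` (phi @^-1` S)); last first.
    by apply/seteqP; split => x; rewrite /S' /preimage /= opprK.
  move=> _; rewrite [leLHS](_ : _ = m [set: E] - m (phi @^-1` S)); last exact: mC.
  rewrite -[X in _ -> _ <= X]/(m (phi @^-1` S)).
  move: (mfin _ mS) (mfin _ measurableT).
  move: (m _) (m _) => [x| |]// [y| |]// _ _.
  rewrite -!EFinB !lee_fin; lra.
Qed.

End quantile.

(** * Conditional thinning *)

Section disintegration.
Context {R : realType} {dE dF : measure_display}.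
Context {E : measurableType dE} {F : measurableType dF}.
Variables (pi : probability E R) (T : {mfun E >-> F}) (kappa : R.-pker F ~> E).
Hypothesis kappa_cond : is_conditional_distribution pi T kappa.

(** A fibre of an injection has at most one point, so it cannot be split. *)
Lemma atomless_fiber (m : {measure set E -> \bar R}) (phi : E -> R) r :
  atomless m -> measurable_fun [set: E] phi -> injective phi ->
  m (phi @^-1` [set r]) = 0.
Proof.
move=> ml mphi phi_inj; have mA : measurable (phi @^-1` [set r]).
  by rewrite -[X in measurable X]setTI; exact: mphi.
apply/eqP; rewrite eq_le measure_ge0 andbT leNgt; apply/negP => /(ml _ mA).
move=> [B [mB BA B0]]; rewrite ltNge => /negP; apply.
apply: le_measure; rewrite ?inE// => x /= xr.
have [y By] : exists y, B y.
  apply: contrapT => /forallNP nB; move: B0.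
  by rewrite (_ : B = set0) ?measure0 ?ltxx//; apply/seteqP; split => // z /nB.
by have /= yr := BA _ By; rewrite (phi_inj x y) ?xr.
Qed.

(** The law of [(T, id)] under [pi] is the composition of the law of [T] with
    [kappa]: both agree on rectangles. *)
Lemma disintegration (G : set (F * E)) : measurable G ->
  pi [set x | G (T x, x)] = \int[distribution pi T]_t kappa t (xsection G t).
Proof.
have mTid : measurable_fun [set: E] (fun x => (T x, x)) by exact: measurable_fun_pair.
have mP H : measurable H -> measurable [set x | H (T x, x)].
  by move=> mH; rewrite -[X in measurable X]setTI; exact: mTid.
have mk H : measurable H -> measurable_fun [set: F] (fun t => kappa t (xsection H t)).
  by move=> mH; apply: measurable_fun_xsection_finite_kernel; rewrite inE.
move=> mG; move: (mG); rewrite measurable_prod_measurableType; move: G {mG}.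
refine (@dynkin_induction _ _ _ (fun G => pi [set x | G (T x, x)] =
  \int[distribution pi T]_t kappa t (xsection G t))
  (measurable_prod_measurableType F E) _ _ _ _ _).
- move=> _ _ [X1 mX1 [X2 mX2 <-]] [Y1 mY1 [Y2 mY2 <-]].
  exists (X1 `&` Y1); first exact: measurableI.
  by exists (X2 `&` Y2); [exact: measurableI|rewrite setXI].
- rewrite (_ : [set x | _] = [set: E])//.
  have xT t : xsection [set: F * E] t = [set: E].
    by rewrite -setXTT in_xsectionX// inE.
  under eq_integral do rewrite xT prob_kernel.
  by rewrite integral_EFin_cst [LHS]probability_setT.
- move=> _ [V mV [B mB <-]].
  rewrite (_ : [set x | _] = B `&` T @^-1` V); last first.
    by apply/seteqP; split => x /= [].
  rewrite kappa_cond// [LHS]integral_mkcond; apply: eq_integral => t _.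
  rewrite patchE; have [tV|tV] := boolP (t \in V).
    by rewrite in_xsectionX.
  by rewrite notin_xsectionX// measure0.
- move=> S mS IH; have mPS := mP _ mS.
  rewrite (_ : [set x | _] = ~` [set x | S (T x, x)])//.
  rewrite -[LHS]/(pi (~` [set x | S (T x, x)])) probability_setC//.
  have -> : \int[distribution pi T]_t kappa t (xsection (~` S) t) =
      \int[distribution pi T]_t (1 - kappa t (xsection S t)).
    apply: eq_integral => t _; have mxS := measurable_xsection t mS.
    rewrite (_ : xsection (~` S) t = [set: E] `\` xsection S t); last first.
      by apply/seteqP; split => y; rewrite /xsection /= !inE// => -[].
    rewrite measureD//; first by rewrite setTI -(prob_kernel (s := kappa) t).
    by rewrite [X in X < _](prob_kernel t) ltry.
  have ki : (distribution pi T).-integrable [set: F] (fun t => kappa t (xsection S t)).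
    apply/integrableP; split; first exact: mk.
    apply: le_lt_trans (ltry 1); rewrite -(integral_EFin_cst (distribution pi T) 1).
    apply: ge0_le_integral => //; first exact: measurableT_comp (mk _ mS).
    move=> t _; rewrite gee0_abs//; rewrite -(prob_kernel (s := kappa) t).
    by apply: le_measure; rewrite ?inE//; exact: measurable_xsection.
  rewrite integralB//; last exact: finite_measure_integrable_cst.
  by rewrite integral_EFin_cst -IH.
- move=> H mH tH IH.
  rewrite (_ : [set x | _] = \bigcup_n [set x | H n (T x, x)]); last first.
    by apply/seteqP; split => x.
  rewrite measure_semi_bigcup//; last 3 first.
  - by move=> n; exact: mP.
  - apply/trivIsetP => i j _ _ ij; apply/seteqP; split => // x [/= Hi Hj].
    by move/trivIsetP : tH => /(_ i j I I ij) HH; have : (H i `&` H j) (T x, x) by []; rewrite HH.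
  - by apply: bigcupT_measurable => n; exact: mP.
  rewrite (@eq_eseriesr _ _ (fun n => \int[distribution pi T]_t
    kappa t (xsection (H n) t))); last by move=> n _; exact: IH.
  rewrite -integral_nneseries//; last by move=> n; exact: mk.
  apply: eq_integral => t _; rewrite xsection_bigcup measure_semi_bigcup//.
  - by move=> n; exact: measurable_xsection.
  - exact: trivIset_xsection.
  - by apply: bigcupT_measurable => n; exact: measurable_xsection.
Qed.

(** The kernel seen over [F * E], to get measurability in [(t, x)] jointly for
    the conditional distribution functions [kappa t {y | phi y <= phi x}]. *)
Definition kernel_fst (p : F * E) : {measure set E -> \bar R} := kappa p.1.

Lemma measurable_kernel_fst U : measurable U ->
  measurable_fun [set: F * E] (kernel_fst ^~ U).
Proof.
move=> mU; apply: (measurableT_comp (measurable_kernel kappa U mU)).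
exact: measurable_fst.
Qed.

HB.instance Definition _ :=
  isKernel.Build _ _ _ _ _ kernel_fst measurable_kernel_fst.

Lemma kernel_fst_uub : measure_fam_uub kernel_fst.
Proof.
exists 2%R => p; rewrite /kernel_fst prob_kernel lte_fin; lra.
Qed.

HB.instance Definition _ :=
  Kernel_isFinite.Build _ _ _ _ _ kernel_fst kernel_fst_uub.

Lemma measurable_kernel_xsection (C : set ((F * E) * E)) : measurable C ->
  measurable_fun [set: F * E] (fun p => kappa p.1 (xsection C p)).
Proof.
move=> mC; apply: (measurable_fun_xsection_finite_kernel kernel_fst).
by rewrite inE.
Qed.

End disintegration.

Section thinning.
Context {R : realType} {dE dF : measure_display}.
Context {E : measurableType dE} {F : measurableType dF}.
Variables (pi : probability E R) (T : {mfun E >-> F}) (kappa : R.-pker F ~> E).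
Hypothesis kappa_cond : is_conditional_distribution pi T kappa.
Hypothesis kappa_atomless :
  {ae distribution pi T, forall t, atomless (kappa t)}.
Variable phi : E -> R.
Hypotheses (mphi : measurable_fun [set: E] phi) (phi_inj : injective phi).
Variable alpha : R.
Hypothesis alpha01 : (0 <= alpha <= 1)%R.

(** Inside each fibre of [T], keep the part of [A] below the conditional
    [alpha]-quantile of [phi]. *)
Lemma conditional_thinning_set (A : set E) : measurable A ->
  exists B, [/\ measurable B, B `<=` A & forall V, measurable V ->
    pi (B `&` T @^-1` V) = alpha%:E * pi (A `&` T @^-1` V)].
Proof.
move=> mA; have /andP[alpha0 alpha1] := alpha01.
pose C := [set q : (F * E) * E | A q.2 /\ (phi q.2 <= phi q.1.2)%R].
have mC : measurable C.
  apply: measurableI.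
    by rewrite -[X in measurable X]setTI; exact: measurable_snd.
  have mle : measurable_fun [set: (F * E) * E]
      (fun q : (F * E) * E => (phi q.2 <= phi q.1.2)%R).
    apply: measurable_fun_ler.
      exact: (measurableT_comp mphi measurable_snd).
    apply: (measurableT_comp mphi).
    exact: (measurableT_comp measurable_snd measurable_fst).
  by have := mle measurableT [set true] I; rewrite setTI; exact.
have CE t x : xsection C (t, x) = [set y | (phi y <= phi x)%R] `&` A.
  by apply/seteqP; split => y; rewrite /xsection /= inE => -[].
(* [(t, x)] is in [G] when [x] is in [A] and below the quantile of fibre [t] *)
pose G := [set p : F * E | A p.2 /\
  kappa p.1 (xsection C p) <= alpha%:E * kappa p.1 A].
have mG : measurable G.
  apply: measurableI.
    by rewrite -[X in measurable X]setTI; exact: measurable_snd.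
  rewrite -[X in measurable X]setTI; apply: measurable_lee => //.
    exact: measurable_kernel_xsection.
  apply: measurable_funeM.
  exact: (measurableT_comp (measurable_kernel kappa A mA) measurable_fst).
have mB : measurable [set x | G (T x, x)].
  have mTid : measurable_fun [set: E] (fun x => (T x, x)) by exact: measurable_fun_pair.
  by rewrite -[X in measurable X]setTI; exact: mTid.
have kA1 t : kappa t A \is a fin_num.
  rewrite ge0_fin_numE// (@le_lt_trans _ _ 1) ?ltry//.
  by rewrite -(prob_kernel (s := kappa) t) le_measure ?inE.
exists [set x | G (T x, x)]; split => //; first by move=> x [].
move=> V mV.
have -> : pi ([set x | G (T x, x)] `&` T @^-1` V) =
    \int[distribution pi T]_(t in V) kappa t (xsection G t).
  have mVE : measurable (V `*` [set: E]) by exact: measurableX.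
  rewrite (_ : _ `&` _ = [set x | (G `&` (V `*` [set: E])) (T x, x)]); last first.
    by apply/seteqP; split => x /=; tauto.
  rewrite (disintegration kappa_cond); last exact: measurableI.
  rewrite [RHS]integral_mkcond; apply: eq_integral => t _; rewrite patchE.
  have [tV|tV] := boolP (t \in V).
    congr (kappa t _); apply/seteqP; split => x; rewrite /xsection/= !inE /=.
      by move=> [].
    by move=> Gx; split => //; split => //; rewrite inE in tV.
  rewrite (_ : xsection _ t = set0) ?measure0//.
  apply/seteqP; split => // x; rewrite /xsection/= inE /= => -[_ [/= Vt _]].
  by move: tV; rewrite notin_setE.
rewrite (kappa_cond mA mV) -ge0_integralZl_EFin//; last first.
  exact/measurable_funTS/measurable_kernel.
apply: ae_eq_integral => //.
- apply: measurable_funTS; apply: measurable_fun_xsection_finite_kernel.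
  by rewrite inE.
- by apply: measurable_funeM; exact/measurable_funTS/measurable_kernel.
apply: filterS kappa_atomless => t katom _.
have mrT : mrestr (kappa t) mA [set: E] = kappa t A by rewrite /mrestr setTI.
have af : alpha%:E * kappa t A \is a fin_num by rewrite fin_numM.
have := @measure_quantile _ _ _ (mrestr (kappa t) mA) phi mphi
  (fine (alpha%:E * kappa t A)).
rewrite fineK// => q.
rewrite -[RHS]q.
- rewrite /mrestr; congr (kappa t _); apply/seteqP; split => x.
    by rewrite /xsection/= inE /= => -[Ax]; rewrite CE.
  by rewrite /xsection/= inE /= => -[h Ax]; split => //; rewrite CE.
- by rewrite [X in X < _]mrT -ge0_fin_numE.
- move=> r; apply/eqP; rewrite eq_le measure_ge0 andbT.
  rewrite -(atomless_fiber r katom mphi phi_inj); apply: le_measure; rewrite ?inE.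
  + by apply: measurableI => //; rewrite -[X in measurable X]setTI; exact: mphi.
  + by rewrite -[X in measurable X]setTI; exact: mphi.
  + by move=> x [].
- by rewrite mule_ge0// lee_fin.
- rewrite [X in _ <= X]mrT -[leRHS]mul1e lee_wpmul2r// lee_fin//.
Qed.

(** The levels of [s] are thinned separately, and the pieces put together. *)
Lemma conditional_thinning (s : E -> nat) : measurable_fun [set: E] s ->
  exists2 B, measurable B & forall n V, measurable V ->
    pi (B `&` s @^-1` [set n] `&` T @^-1` V) =
    alpha%:E * pi (s @^-1` [set n] `&` T @^-1` V).
Proof.
move=> ms; have mL n : measurable (s @^-1` [set n]).
  by rewrite -[X in measurable X]setTI; exact: ms.
have [B_ HB] := choice (fun n => conditional_thinning_set (mL n)).
exists (\bigcup_n B_ n); first by apply: bigcupT_measurable => n; have [] := HB n.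
move=> n V mV; have [_ _ <-//] := HB n.
congr (pi (_ `&` _)); apply/seteqP; split => x.
  move=> [[k _ Bx] /= sx]; have [_ /(_ _ Bx) /= sk _] := HB k.
  by rewrite -sx sk.
by move=> Bx; split; [exists n|have [_ /(_ _ Bx)] := HB n].
Qed.

End thinning.

(** * Targets with an indicator density *)

Section reweighting.
Context {R : realType} {dE dF : measure_display}.
Context {E : measurableType dE} {F : measurableType dF}.
Implicit Types (P : probability E R) (T : {mfun E >-> F}).

Lemma ge0_integral_mrestr P D (mD : measurable D) C (f : E -> \bar R) :
  measurable C -> measurable_fun [set: E] f -> (forall x, 0 <= f x) ->
  \int[mrestr P mD]_(x in C) f x = \int[P]_(x in C `&` D) f x.
Proof.
move=> mC mf f0; have mDc := measurableC mD.
have mCD : measurable (C `&` D) by exact: measurableI.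
rewrite (ge0_negligible_integral mDc)//; last 2 first.
- exact: measurable_funTS.
- by rewrite -[LHS]/(mrestr P mD (~` D)) /mrestr setICl measure0.
rewrite setDE setCK (eq_measure_integral P)//.
move=> A mA; rewrite subsetI => -[_ AD]; rewrite -[LHS]/(mrestr P mD A) /mrestr setIidl//.
Qed.

(** Both sides are integrals of [g] against the image under [T] of a restriction
    of [pi], and these two images are proportional. *)
Lemma reweight_proportional (pi mu : probability E R) T (g : F -> R) (alpha : R)
    (B D : set E) :
  (0 <= alpha)%R -> measurable_fun [set: F] g -> (forall t, (0 <= g t)%R) ->
  density_of mu pi (g \o T) -> measurable B -> measurable D ->
  (forall V, measurable V ->
    pi (B `&` T @^-1` V) = alpha%:E * pi (D `&` T @^-1` V)) ->
  forall V, measurable V ->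
    mu (B `&` T @^-1` V) = alpha%:E * mu (D `&` T @^-1` V).
Proof.
move=> a0 mg g0 [_ _ muE] mB mD piBD V mV.
have mEg : measurable_fun [set: F] (EFin \o g) by exact/measurable_EFinP.
have mTV : measurable (T @^-1` V) by exact: measurable_funPTI.
have muH H (mH : measurable H) : mu (H `&` T @^-1` V) =
    \int[pushforward (mrestr pi mH) T]_(t in V) (g t)%:E.
  rewrite ge0_integral_pushforward//; last 2 first.
  - exact: measurable_funTS.
  - by move=> t _; rewrite lee_fin.
  rewrite ge0_integral_mrestr//; last 2 first.
  - exact: (measurableT_comp mEg).
  - by move=> x; rewrite lee_fin.
  by rewrite setIC muE//; exact: measurableI.
rewrite (muH _ mB) (muH _ mD) -(ge0_integral_mscale _ _ (NngNum a0))//; last 2 first.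
- exact: measurable_funTS.
- by move=> t _; rewrite lee_fin.
apply: eq_measure_integral => A mA _.
have := piBD A mA; rewrite setIC [in RHS]setIC; exact.
Qed.

Lemma proportional_labels (mu : probability E R) T (alpha : R) (B : set E)
    (s : E -> nat) :
  (0 <= alpha)%R -> measurable_fun [set: E] s -> measurable B ->
  (forall n V, measurable V -> mu (B `&` s @^-1` [set n] `&` T @^-1` V) =
    alpha%:E * mu (s @^-1` [set n] `&` T @^-1` V)) ->
  forall U V, measurable V -> mu (B `&` (s @^-1` U `&` T @^-1` V)) =
    alpha%:E * mu (s @^-1` U `&` T @^-1` V).
Proof.
move=> a0 ms mB H U V mV.
have mTV : measurable (T @^-1` V) by exact: measurable_funPTI.
have mL n : measurable (s @^-1` [set n]).
  by rewrite -[X in measurable X]setTI; exact: ms.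
have mLV n : measurable (s @^-1` [set n] `&` T @^-1` V) by exact: measurableI.
have -> : s @^-1` U `&` T @^-1` V =
    \bigcup_(n in U) (s @^-1` [set n] `&` T @^-1` V).
  apply/seteqP; split => [x [Ux Vx]|x [n Un [/= sx Vx]]]; first by exists (s x).
  by split => //; rewrite /preimage /= sx.
have tL : trivIset U (fun n => s @^-1` [set n] `&` T @^-1` V).
  by move=> i j _ _ [x [[/= <- _] [/= <- _]]].
rewrite setI_bigcupr measure_bigcup//; last 2 first.
- by move=> n _; exact: measurableI.
- by move=> i j _ _ [x [[_ [/= <- _]] [_ [/= <- _]]]].
rewrite measure_bigcup// -nneseriesZl//.
by apply: eq_eseriesr => n _; rewrite setIA; exact: H.
Qed.

End reweighting.

Section indicator.
Context {R : realType} {d : measure_display} {E : measurableType d}.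
Implicit Types (mu eta nu : probability E R).

Lemma indicator_probability mu B (c : R) : measurable B -> (0 <= c)%R ->
  c%:E * mu B = 1 ->
  exists2 eta, density_of eta mu (fun x => c * \1_B x)%R &
    forall A, measurable A -> eta A = c%:E * mu (B `&` A).
Proof.
move=> mB c0 cB.
have mc : measurable_fun [set: E] (fun x => c * \1_B x)%R.
  by apply: measurable_funM => //; exact: measurable_indic.
have cE A : measurable A -> \int[mu]_(x in A) (c * \1_B x)%:E = c%:E * mu (B `&` A).
  move=> mA; under eq_integral do rewrite EFinM.
  rewrite ge0_integralZl_EFin//; first by rewrite integral_indic.
  by apply/measurable_EFinP; apply: measurable_funTS; exact: measurable_indic.
have [x||eta deta] := @probability_of_density _ _ _ mu _ mc.
- by rewrite mulr_ge0.
- by rewrite cE// setIT.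
- by exists eta => // A mA; have [_ _ ->//] := deta; exact: cE.
Qed.

Lemma indicator_neg_integrable mu eta B (c : R) (f : E -> R) :
  measurable B -> (0 <= c)%R -> density_of eta mu (fun x => c * \1_B x)%R ->
  measurable_fun [set: E] f -> neg_integrable mu f -> neg_integrable eta f.
Proof.
move=> mB c0 deta /measurable_EFinP mf nf; rewrite /neg_integrable.
have mn := measurable_funeneg mf.
rewrite (density_integral deta)//.
apply: (@le_lt_trans _ _ (c%:E * \int[mu]_x ((EFin \o f)^\- x))); last first.
  have := nf; rewrite /neg_integrable -ge0_fin_numE; last exact: integral_ge0.
  by move=> nfin; rewrite ltey_eq fin_numM.
rewrite -ge0_integralZl_EFin//; apply: ge0_le_integral => //.
- by move=> x _; rewrite mule_ge0// lee_fin mulr_ge0.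
- apply: emeasurable_funM => //; apply/measurable_EFinP.
  by apply: measurable_funM => //; exact: measurable_indic.
- exact: measurable_funeM.
- move=> x _; rewrite muleC lee_wpmul2r// lee_fin indicE.
  by case: (_ \in _); rewrite ?mulr1// mulr0.
Qed.

(** The density of [eta] with respect to [nu] is [c 1_B q], and [B] has full
    measure under [eta]. *)
Lemma indicator_Ent nu mu eta B (c : R) (q : E -> R) :
  measurable B -> (0 < c)%R -> density_of eta mu (fun x => c * \1_B x)%R ->
  density_of mu nu q ->
  Ent eta nu = \int[eta]_x (ln (q x))%:E + (ln c)%:E.
Proof.
move=> mB c0 deta dq; have [mq q0 muE] := dq; have [mc _ etaE] := deta.
have mcq : measurable_fun [set: E] (fun x => c * \1_B x * q x)%R.
  exact: measurable_funM.
have dcq : density_of eta nu (fun x => c * \1_B x * q x)%R.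
  split => // [x|A mA]; first by rewrite !mulr_ge0// ltW.
  rewrite etaE// (density_integral dq)//.
  - by move=> x; rewrite lee_fin mulr_ge0// ltW.
  - exact/measurable_EFinP.
have mlq := measurable_fun_ln mq.
have nlq : neg_integrable eta (fun x => ln (q x)).
  apply: (indicator_neg_integrable mB (ltW c0) deta mlq).
  exact: density_neg_integrable dq.
have ic : eta.-integrable [set: E] (EFin \o cst (ln c)).
  exact: finite_measure_integrable_cst.
rewrite (Ent_density dcq) -(integral_EFin_cst eta (ln c)) -(neg_integralD mlq nlq ic).
apply: ae_eq_integral_real.
- exact: measurable_fun_ln.
- exact: measurable_funD.
- have := density_gt0 dcq; have := density_gt0 deta.
  apply: filterS2 => x.
  rewrite indicE; case: (_ \in _); rewrite ?mulr0 ?ltxx// mulr1 => _ cqx.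
  have qx : (0 < q x)%R by rewrite -(pmulr_rgt0 _ c0).
  by rewrite lnM ?posrE// addrC.
Qed.

End indicator.

Section labels.
Context {R : realType} {d : measure_display} {E : measurableType d}.
Implicit Types (mu eta : probability E R).

(** The integer part of [f / e], encoded as a natural number so that labels
    live in a type all of whose subsets are measurable. *)
Definition floor_label (f : E -> R) (e : R) (x : E) : nat :=
  pickle (Num.floor (f x / e)).

(** The default 0 is for the natural numbers that encode no integer. *)
Definition label_value (e : R) (n : nat) : R :=
  ((odflt 0%Z (unpickle n))%:~R * e)%R.

Lemma label_value_floor f e x :
  label_value e (floor_label f e x) = ((Num.floor (f x / e))%:~R * e)%R.
Proof. by rewrite /label_value /floor_label pickleK. Qed.

Lemma floor_label_bounds f e x : (0 < e)%R ->
  (label_value e (floor_label f e x) <= f x)%R /\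
  (f x <= label_value e (floor_label f e x) + e)%R.
Proof.
move=> e0; rewrite label_value_floor.
have := Num.Theory.floor_le (f x / e)%R; have := Num.Theory.lt_succ_floor (f x / e)%R.
rewrite ler_pdivlMr// ltr_pdivrMr// intrD mulrDl mul1r => /ltW.
by [].
Qed.

Lemma measurable_floor_label f e : measurable_fun [set: E] f ->
  measurable_fun [set: E] (floor_label f e).
Proof.
move=> mf _ U _; rewrite setTI.
have mfl : measurable_fun [set: E] (fun x => (Num.floor (f x / e))%:~R : R).
  have mfloor : measurable_fun [set: R] (fun y : R => (Num.floor y)%:~R : R).
    apply: nondecreasing_measurable => // x y xy.
    by rewrite ler_int; exact: Num.Theory.le_floor.
  by apply: (measurableT_comp mfloor); exact: measurable_funM.
rewrite (_ : _ @^-1` U = \bigcup_(n in [set n | U (pickle (odflt 0%Z (unpickle n)))])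
  ((fun x => (Num.floor (f x / e))%:~R : R) @^-1` [set (odflt 0%Z (unpickle n))%:~R])).
  apply: bigcup_measurable => n _.
  by rewrite -[X in measurable X]setTI; exact: mfl.
apply/seteqP; split => [x Ux|x [n /= Un /= /intr_inj fx]].
  by exists (floor_label f e x); rewrite /= /floor_label pickleK.
by rewrite /preimage /= /floor_label fx.
Qed.

(** The value attached to the label of [x] lies in [[f x - e, f x]], and its
    integral only depends on the law of the labels. *)
Lemma floor_label_integral mu eta f e : (0 < e)%R ->
  measurable_fun [set: E] f -> neg_integrable mu f ->
  (forall U, eta (floor_label f e @^-1` U) = mu (floor_label f e @^-1` U)) ->
  \int[mu]_x (f x)%:E - e%:E <= \int[eta]_x (f x)%:E.
Proof.
move=> e0 mf nf etamu; have ms := measurable_floor_label e mf.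
pose s : {mfun E >-> nat} := HB.pack (floor_label f e) (isMeasurableFun.Build _ _ _ _ _ ms).
pose v x := label_value e (s x).
have mlv : measurable_fun [set: nat] (label_value e) by [].
have mv : measurable_fun [set: E] v by exact: measurableT_comp.
have vE P : \int[distribution P s]_n (label_value e n)%:E = \int[P]_x (v x)%:E.
  exact: integral_distribution_real.
have vetamu : \int[eta]_x (v x)%:E = \int[mu]_x (v x)%:E.
  rewrite -!vE; apply: same_distribution_integral => U _; exact: etamu.
have bnd x := floor_label_bounds f x e0.
have ine P : (P : probability E R).-integrable [set: E] (EFin \o cst (- e)%R).
  exact: finite_measure_integrable_cst.
have mfe : measurable_fun [set: E] (fun x => f x + cst (- e) x)%R by exact: measurable_funD.
rewrite -EFinN -(integral_EFin_cst mu (- e)) -(neg_integralD mf nf (ine mu)).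
apply: (@le_trans _ _ (\int[mu]_x (v x)%:E)).
  by apply: ae_le_integral => //; apply: aeW => x; have [_] := bnd x; rewrite lerBlDr.
rewrite -vetamu; apply: ae_le_integral => //.
by apply: aeW => x; have [] := bnd x.
Qed.

End labels.

Section thinned_target.
Context {R : realType} {dE dF : measure_display}.
Context {E : measurableType dE} {F : measurableType dF}.
Variables (pi mu : probability E R) (T : {mfun E >-> F}) (kappa : R.-pker F ~> E).
Hypothesis E_borel : standard_borel R E.
Hypothesis kappa_cond : is_conditional_distribution pi T kappa.
Hypothesis kappa_atomless :
  {ae distribution pi T, forall t, atomless (kappa t)}.
Variable g : F -> R.
Hypotheses (mg : measurable_fun [set: F] g) (g0 : forall t, (0 <= g t)%R).
Hypothesis dmu : density_of mu pi (g \o T).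

(** Thinning in proportion [c^-1] and renormalizing leaves the law of [T] and the
    law of the label unchanged. *)
Lemma thinned_target (c : R) (s : E -> nat) : (1 <= c)%R ->
  measurable_fun [set: E] s ->
  exists B, exists2 eta, density_of eta mu (fun x => c * \1_B x)%R &
    [/\ measurable B, has_indicator_density mu eta,
        same_distribution (distribution mu T) (distribution eta T) &
        forall U, eta (s @^-1` U) = mu (s @^-1` U)].
Proof.
move=> c1 ms; have c0 : (0 < c)%R by lra.
have ci01 : (0 <= c^-1 <= 1)%R by rewrite invr_ge0 ltW//= invf_le1.
have /andP[ci0 _] := ci01.
have [U [mU sepU]] := standard_borel_separating E_borel.
have [phi mphi phi_inj] := separating_real_injection (R := R) mU sepU.
have [B mB HB] := conditional_thinning kappa_cond kappa_atomless mphi phi_inj ci01 ms.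
have mL n : measurable (s @^-1` [set n]).
  by rewrite -[X in measurable X]setTI; exact: ms.
have muL : forall n V, measurable V -> mu (B `&` s @^-1` [set n] `&` T @^-1` V) =
    (c^-1)%:E * mu (s @^-1` [set n] `&` T @^-1` V).
  move=> n; apply: (reweight_proportional ci0 mg g0 dmu) => //.
  - exact: measurableI.
  - exact: HB.
have muUV := proportional_labels ci0 ms mB muL.
have muB : mu B = (c^-1)%:E.
  have := muUV setT setT measurableT.
  by rewrite !preimage_setT !setIT [X in _ * X]probability_setT mule1.
have cK x : c%:E * ((c^-1)%:E * x) = x by rewrite muleA -EFinM divff ?mul1e// gt_eqF.
have [|eta deta etaE] := indicator_probability (mu := mu) mB (ltW c0).
  by rewrite muB -EFinM divff// gt_eqF.
exists B; exists eta => //; split => //.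
- exists B; split => //; first by rewrite muB lte_fin invr_gt0.
  by move=> A mA; rewrite etaE// muB /= invrK.
- move=> V mV; rewrite -[RHS]/(eta (T @^-1` V)) etaE; last exact: measurable_funPTI.
  have := muUV setT V mV; rewrite preimage_setT !setTI => ->.
  by rewrite cK.
- move=> W; rewrite etaE; last by rewrite -[X in measurable X]setTI; exact: ms.
  by have := muUV W setT measurableT; rewrite preimage_setT !setIT => ->; rewrite cK.
Qed.

End thinned_target.

Unset Implicit Arguments.

Theorem theorem3p3 (R : realType) (dE dF : measure_display)
  (E : measurableType dE) (F : measurableType dF)
  (E_borel : standard_borel R E) (F_borel : standard_borel R F)
  (pi : probability E R) (T : {mfun E >-> F})
  (CT : set (probability F R))
  (CT_set : distribution_set CT)
  (CT_convex : convex_distribution_set CT)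
  (mustar : probability E R)
  (mustar_min :
     is_unique_entropy_minimizer (constraint_set T CT) pi mustar)
  (mustar_fin : Ent mustar pi < +oo)
  (A : set (probability E R))
  (A_set : distribution_set A)
  (A_sub : A `<=` constraint_set T CT)
  (kappa : R.-pker F ~> E)
  (kappa_cond : is_conditional_distribution pi T kappa)
  (kappa_atomless :
     {ae distribution pi T, forall t, atomless (kappa t)})
  (A_indic : forall eta : probability E R, constraint_set T CT eta ->
     has_indicator_density mustar eta -> A eta)
  (h : R) (h_ge : Ent mustar pi <= h%:E) :
  [/\ forall (f : E -> R) (eps : R), measurable_fun [set: E] f ->
        [bounded f x | x in [set: E]] -> (0 < eps)%R ->
        exists2 eta : probability E R, A eta &
          `|Ent eta pi - h%:E| <= eps%:E /\
          \int[mustar]_x (f x)%:E - eps%:E <= \int[eta]_x (f x)%:E,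
      WLC A pi h mustar = - Ent mustar pi &
      forall mu : probability E R,
        WLC A pi h mustar + Ent mustar mu <= WLC A pi h mu].
Proof.
have [Cmu minmu] := mustar_min.
have [g [mg g0 dg]] := minimizer_density CT_set mustar_min mustar_fin.
have [hs hsE] : exists hs, Ent mustar pi = hs%:E.
  have := Ent_gtNy mustar pi; move: mustar_fin.
  by case: (Ent mustar pi) => // hs _ _; exists hs.
have hsh : (hs <= h)%R by rewrite -lee_fin -hsE.
(* [c] is the inverse of the proportion kept, chosen so that the entropy is [h] *)
pose c := expR (h - hs).
have c1 : (1 <= c)%R by rewrite -expR0 ler_expR subr_ge0.
have c0 : (0 < c)%R by exact: expR_gt0.
have lnc : ln c = (h - hs)%R by rewrite expRK.
have mlg := measurable_fun_ln mg.
have target (s : E -> nat) : measurable_fun [set: E] s ->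
    exists B, exists2 eta, density_of eta mustar (fun x => c * \1_B x)%R &
    [/\ measurable B, A eta, Ent eta pi = h%:E &
        forall U, eta (s @^-1` U) = mustar (s @^-1` U)].
  move=> ms.
  have [B [eta deta [mB ind sT sU]]] :=
    thinned_target E_borel kappa_cond kappa_atomless mg g0 dg c1 ms.
  exists B; exists eta => //; split => //.
    by apply: A_indic => //; exact: CT_set sT Cmu.
  rewrite (indicator_Ent mB c0 deta dg) /= -(integral_distribution_real eta T mlg).
  rewrite -(same_distribution_integral _ sT) integral_distribution_real//.
  by have := Ent_density dg; rewrite /= hsE => <-; rewrite lnc -EFinD addrC subrK.
have Ent_target eta B :
    density_of eta mustar (fun x => c * \1_B x)%R -> measurable B ->
    Ent eta mustar = (h - hs)%:E.
  move=> deta mB.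
  have d1 : density_of mustar mustar (cst 1%R).
    split => // D mD; rewrite -[RHS]/(\int[mustar]_(x in D) cst 1 x).
    by rewrite integral_cst// mul1e.
  rewrite (indicator_Ent mB c0 deta d1) /=.
  by rewrite ln1 (integral_EFin_cst eta 0) add0e lnc.
have convC : convex_distribution_set (constraint_set T CT).
  move=> p m0 m1 nu p01 C0 C1 nuE; apply: (CT_convex p _ _ _ p01 C0 C1) => V mV.
  exact/nuE/measurable_funPTI.
have WLC_star : WLC A pi h mustar = - Ent mustar pi.
  rewrite /WLC (_ : ereal_sup _ = (h - hs)%:E).
    by rewrite hsE -EFinN -EFinN -EFinD; congr EFin; ring.
  apply/eqP; rewrite eq_le; apply/andP; split.
    apply: ge_ereal_sup => _ [eta [Aeta etah] <-].
    have := pythagoras convC Cmu (A_sub _ Aeta) (fun nu Cnu => (minmu nu Cnu).1) mustar_fin.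
    by rewrite hsE => /le_trans/(_ etah); rewrite EFinB leeBrDr.
  have ms0 : measurable_fun [set: E] (fun=> 0%N) by exact: measurable_cst.
  have [B [eta deta [mB Aeta Eh _]]] := target _ ms0.
  apply: ereal_sup_ubound; exists eta; last exact: Ent_target deta mB.
  by split => //; rewrite Eh.
split => //.
- move=> f eps mf bf eps0.
  have [B [eta deta [mB Aeta Eh etaU]]] := target _ (measurable_floor_label eps mf).
  exists eta => //; split; first by rewrite Eh subee// abse0 lee_fin ltW.
  apply: floor_label_integral => //; apply: integrable_neg_integrable.
  apply: measurable_bounded_integrable => //.
  by rewrite [X in X < _]probability_setT ltry.
- move=> mu; rewrite WLC_star hsE.
  have [mustar_mu|nmustar_mu] := pselect (mustar `<< mu); last first.
    have Einf : Ent mustar mu = +oo by rewrite /Ent asboolF.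
    rewrite [X in _ <= X](_ : _ = +oo) ?leey//.
    rewrite /WLC (_ : ereal_sup _ = +oo)//.
    apply/eqP; rewrite -leye_eq -Einf.
    apply: ereal_sup_ubound; exists mustar => //; split => //.
    apply: A_indic => //; exists setT; split => //.
      by rewrite [X in _ < X]probability_setT.
    move=> D mD; rewrite setTI probability_setT /= invr1 mul1e//.
  have [q dq] := density_exists mustar_mu; have [mq q0 muE] := dq.
  have mlq := measurable_fun_ln mq.
  apply/lee_subgt0Pr => e e0.
  have [B [eta deta [mB Aeta Eh etaU]]] := target _ (measurable_floor_label e mlq).
  apply: (@le_trans _ _ (Ent eta mu - h%:E)); last first.
    rewrite /WLC leeB//; apply: ereal_sup_ubound; exists eta => //.
    by split => //; rewrite Eh.
  have := floor_label_integral e0 mlq (density_neg_integrable dq) etaU.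
  rewrite (indicator_Ent mB c0 deta dq) (Ent_density dq) lnc.
  move=> le_label; rewrite -[leLHS]addeA [leLHS]addeC -[leRHS]addeA -EFinB.
  by rewrite (_ : h - hs - h = - hs)%R; [exact: leeD2r|ring].
Qed.
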